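(* Let $g$ be an arithmetic function and let $f(n)=\sum_{d\mid n}g(d)$ for every $n\geqslant 1$. Suppose that $f(n),g(n)\ll_{\alpha}n^{\alpha}$ for some fixed $\alpha$ with $0<\alpha<1$. For $\operatorname{Re} z>1+\alpha$ let $L(z;f)=\sum_{n=1}^{+\infty}\frac{f(n)}{n^{z}}$. Then for every integer $k\geqslant 1$, $$\frac{1}{2}\,L^{2}(2k+1;f)=\sum_{m=1}^{+\infty}\frac{g(m)}{m}\biggl(\,\sum_{n=1}^{+\infty}\frac{f(n)}{n^{4k+1}}\,c_{k}\Bigl(\frac{n}{m}\Bigr)-mL(4k+2;f)\biggr).$$
   Context: An arithmetic function is a complex-valued function on the positive integers. The notation $h(n)\ll_{\alpha}n^{\alpha}$ means that there is a constant $C$ (depending on $\alpha$) with $|h(n)|\leqslant Cn^{\alpha}$ for all $n\geqslant 1$. $\psi(z)=\Gamma'(z)/\Gamma(z)$ is the digamma function. For integers $k\geqslant 1$ and $r\geqslant 0$ put $\omega_{r}=\omega_{r}(k)=\exp\bigl(\frac{2\pi i(r+1/2)}{2k+1}\bigr)$. For real $w>0$ define $c_{k}(w)=\frac{1}{2k+1}\sum_{r=0}^{2k}\omega_{r}\psi(-\omega_{r}w)$. *)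

(* Defs.v *)
From Stdlib Require Import Reals Arith.
From Coquelicot Require Import Coquelicot.

(** Everything is over Stdlib's [R] and Coquelicot's [C].  An arithmetic
    function is a map [nat -> C] whose value at 0 is never used; a series over
    [n >= 1] is therefore a Coquelicot series with general term taken at
    [S i]. *)

Local Open Scope C_scope.

(** The values below are meaningful when the sequence (series) converges in
    [C]; convergence itself is expressed with [ex_series] and [is_series]. *)
Definition CLim_seq (u : nat -> C) : C :=
  (real (Lim_seq (fun n => Re (u n))), real (Lim_seq (fun n => Im (u n)))).

Definition CSeries (a : nat -> C) : C := CLim_seq (sum_n a).

Definition Cexp (z : C) : C :=
  ((exp (Re z) * cos (Im z))%R, (exp (Re z) * sin (Im z))%R).

(** [n] to the complex power [z], for [n >= 1]. *)
Definition nat_Cpower (n : nat) (z : C) : C := Cexp (z * RtoC (ln (INR n))).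

(** [rising z n = z (z + 1) ... (z + n)], with [n + 1] factors. *)
Fixpoint rising (z : C) (n : nat) : C :=
  match n with
  | O => z
  | S p => rising z p * (z + RtoC (INR n))
  end.

(** Gauss' form of Euler's definition: Gamma(z) is the limit of
    [n! n^z / (z (z + 1) ... (z + n))], for every complex [z] other than
    0, -1, -2, ... *)
Definition Gamma (z : C) : C :=
  CLim_seq (fun n => RtoC (INR (fact n)) * nat_Cpower n z / rising z n).

(** [C_derive] is Coquelicot's total complex derivative; it is the derivative
    wherever the function is complex differentiable. *)
Definition digamma (z : C) : C := C_derive Gamma z / Gamma z.

Definition omega (k r : nat) : C :=
  Cexp (2 * RtoC PI * Ci * (RtoC (INR r) + 1 / 2) / RtoC (INR (2 * k + 1))).

(** For [w > 0], [- omega k r * w] is never a pole of [digamma], since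
    [omega k r] is either -1 or not real. *)
Definition c (k : nat) (w : R) : C :=
  1 / RtoC (INR (2 * k + 1)) *
  sum_n (fun r => omega k r * digamma (- omega k r * RtoC w)) (2 * k).

Definition divisor_sum (g : nat -> C) (n : nat) : C :=
  sum_n_m (fun d => if Nat.eqb (n mod d) 0 then g d else RtoC 0) 1 n.

Definition dominated (h : nat -> C) (alpha : R) : Prop :=
  exists K : R, forall n : nat, (1 <= n)%nat ->
    (Cmod (h n) <= K * Rpower (INR n) alpha)%R.

Definition L (z : C) (f : nat -> C) : C :=
  CSeries (fun i => f (S i) / nat_Cpower (S i) z).

(** General term, for [n >= 1], of the inner series attached to [m]. *)
Definition inner_term (f : nat -> C) (k m n : nat) : C :=
  f n / RtoC (INR n) ^ (4 * k + 1) * c k (INR n / INR m).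

(* Main.v *)
Require Import Defs.
From Stdlib Require Import Reals Arith Lra Lia.
From Coquelicot Require Import Coquelicot.

(** The digamma function enters only through [c k w], and that combination of
    digamma values collapses to an elementary series.  Gauss' limit for Gamma
    gives, away from the poles,

      psi(z) = lim_n (ln n - sum_(j <= n) 1 / (z + j))   ([digamma_lim]).

    The numbers [omega k r], for [r <= 2k], are the [q]-th roots of -1, where
    [q = 2k + 1].  Their sum vanishes, which removes [ln n], and expanding
    [1 / (j - omega w)] over the common denominator [j^q + w^q] leaves only the
    power of the roots that does not average to zero ([sum_omega_pow],
    [omega_partial_fractions]):

      c_k(w) = sum_(j >= 0) w^(2k) / (j^q + w^q)   ([c_series]).

    For [w = n / m] the term [j = 0] is [m / n]; it produces the term
    [m L(4k+2; f)] that the statement subtracts.  With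
    [b(l) = sum_n f(n) / (n^q (l^q + n^q))] (the function [stieltjes] below),
    the right-hand side is therefore

      sum_m g(m) sum_(j >= 1) b(j m) = sum_l (sum_(m | l) g(m)) b(l)
                                     = sum_l f(l) b(l)

    ([stieltjes_multiples], [divisor_series_swap]).  The last expression is the
    double series of [f(l) f(n) / (n^q (l^q + n^q))]; exchanging the names of
    [l] and [n] and averaging turns the weight into

      (1/2) (1 / n^q + 1 / l^q) / (l^q + n^q) = (1/2) / (l^q n^q),

    so the double series factors as half the square of [L(q; f)]
    ([stieltjes_symmetrized]).

    All three exchanges of summations go through [double_series_swap], whose
    hypothesis is a majorant of product form [u i * v j].  The only place where
    such a majorant is not immediate is the regrouping along divisors: there
    [m <= l] is used to share the decay of [1 / l^q] evenly between [m] and [l]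
    ([Rpower_tradeoff]); this is possible because [alpha < 1] and [3 <= q].

    The limit formula for psi is a statement about [C_derive], which
    differentiates along the horizontal line through [z].  On a short segment of
    that line the Euler products [P_n] satisfy
    [|P_(n+1) / P_n - 1| <= K (1/n - 1/(n+1))] with [K] uniform
    ([euler_product_step]), and the same telescoping majorant controls their
    logarithmic derivatives ([euler_logder_step]).  Hence [P_n] and [P_n'] both
    converge uniformly, the limit does not vanish, and differentiation commutes
    with the limit. *)

Local Open Scope R_scope.

(** * Complex sequences and series *)

(* Sums computed by [sum_n] live in the carrier of an abstract structure; the
   tactics [ring] and [field] need the equation to be typed in [C]. *)
Ltac eq_in_C := match goal with |- @eq _ ?a ?b => change (@eq C a b) end.

(** Convergence is split into real and imaginary parts because [CLim_seq] and
    [C_derive] are computed componentwise; [is_Clim_seq_filterlim] links it to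
    the topology of [C] that [is_series] refers to. *)
Definition is_Clim_seq (u : nat -> C) (l : C) : Prop :=
  is_lim_seq (fun n => Re (u n)) (Re l) /\ is_lim_seq (fun n => Im (u n)) (Im l).

Lemma C_eq (z w : C) : Re z = Re w -> Im z = Im w -> z = w.
Proof. destruct z, w; simpl; intros; subst; reflexivity. Qed.

Lemma Im_le_Cmod (z : C) : Rabs (Im z) <= Cmod z.
Proof.
  eapply Rle_trans; [ | apply Rmax_Cmod ].
  apply (Rmax_r (Rabs (fst z)) (Rabs (snd z))).
Qed.

Lemma Cmod_le_Re_Im (z : C) : Cmod z <= Rabs (Re z) + Rabs (Im z).
Proof.
  replace z with (RtoC (Re z) + Ci * RtoC (Im z))%C at 1
    by (apply C_eq; simpl; ring).
  eapply Rle_trans; [ apply Cmod_triangle | ].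
  rewrite Cmod_mult, !Cmod_R.
  assert (H : Cmod Ci = 1).
  { unfold Cmod, Ci; simpl.
    replace (0 * (0 * 1) + 1 * (1 * 1)) with 1 by ring. apply sqrt_1. }
  rewrite H; lra.
Qed.

Lemma Cmod_minus_sym (z w : C) : Cmod (z - w)%C = Cmod (w - z)%C.
Proof. rewrite <- Cmod_opp. f_equal. ring. Qed.

Lemma is_Clim_seq_filterlim (u : nat -> C) (l : C) :
  is_Clim_seq u l <-> filterlim u eventually (locally l).
Proof.
  split.
  - intros [Hr Hi]. apply is_lim_seq_spec in Hr. apply is_lim_seq_spec in Hi.
    apply (proj2 (filterlim_locally (U := C_UniformSpace) u l)).
    intros eps.
    generalize (filter_and _ _ (Hr eps) (Hi eps)).
    apply filter_imp. intros n [H1 H2]. split; assumption.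
  - intros H.
    assert (H' := proj1 (filterlim_locally (U := C_UniformSpace) u l) H).
    split; apply is_lim_seq_spec; intros eps; generalize (H' eps);
      apply filter_imp; intros n [H1 H2]; assumption.
Qed.

Lemma CLim_seq_unique (u : nat -> C) (l : C) : is_Clim_seq u l -> CLim_seq u = l.
Proof.
  intros [Hr Hi]. unfold CLim_seq.
  rewrite (is_lim_seq_unique _ _ Hr), (is_lim_seq_unique _ _ Hi).
  destruct l; reflexivity.
Qed.

Lemma is_Clim_seq_ext (u v : nat -> C) (l : C) :
  (forall n, u n = v n) -> is_Clim_seq u l -> is_Clim_seq v l.
Proof.
  intros H [Hr Hi].
  split; [ eapply is_lim_seq_ext, Hr | eapply is_lim_seq_ext, Hi ];
    intros n; simpl; rewrite H; reflexivity.
Qed.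

Lemma is_Clim_seq_const (l : C) : is_Clim_seq (fun _ => l) l.
Proof. split; apply is_lim_seq_const. Qed.

Lemma is_Clim_seq_plus (u v : nat -> C) (l m : C) :
  is_Clim_seq u l -> is_Clim_seq v m ->
  is_Clim_seq (fun n => u n + v n)%C (l + m)%C.
Proof. intros [] []. split; apply is_lim_seq_plus'; assumption. Qed.

Lemma is_Clim_seq_mult (u v : nat -> C) (l m : C) :
  is_Clim_seq u l -> is_Clim_seq v m ->
  is_Clim_seq (fun n => u n * v n)%C (l * m)%C.
Proof.
  intros [] []. split.
  - apply is_lim_seq_minus'; apply is_lim_seq_mult'; assumption.
  - apply is_lim_seq_plus'; apply is_lim_seq_mult'; assumption.
Qed.

Lemma is_Clim_seq_sum_n (u : nat -> nat -> C) (l : nat -> C) (N : nat) :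
  (forall r, (r <= N)%nat -> is_Clim_seq (u r) (l r)) ->
  is_Clim_seq (fun n => sum_n (fun r => u r n) N) (sum_n l N).
Proof.
  induction N as [ | N IH ]; intros H.
  - rewrite sum_O. eapply is_Clim_seq_ext; [ | apply (H 0%nat); lia ].
    intros n. now rewrite sum_O.
  - rewrite sum_Sn.
    eapply is_Clim_seq_ext;
      [ | apply is_Clim_seq_plus; [ apply IH; intros; apply H; lia | apply (H (S N)); lia ] ].
    intros n; simpl. now rewrite sum_Sn.
Qed.

Lemma is_Clim_seq_Cmod (u : nat -> C) (l : C) :
  is_Clim_seq u l -> is_lim_seq (fun n => Cmod (u n)) (Cmod l).
Proof.
  intros H. apply is_Clim_seq_filterlim in H.
  eapply (filterlim_comp _ _ _ u Cmod); [ exact H | ].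
  apply (filterlim_norm (V := C_NormedModule) l).
Qed.

Lemma is_Clim_seq_of_Cmod (u : nat -> C) (l : C) :
  is_lim_seq (fun n => Cmod (u n - l)%C) 0 -> is_Clim_seq u l.
Proof.
  intros H.
  assert (Hc : forall (a : nat -> R) (b : R),
             (forall n, Rabs (a n - b) <= Cmod (u n - l)%C) -> is_lim_seq a b).
  { intros a b Hab.
    apply is_lim_seq_ext with (fun n => (a n - b) + b); [ intros; ring | ].
    replace (Finite b) with (Rbar_plus 0 b) by (simpl; f_equal; ring).
    apply is_lim_seq_plus'; [ | apply is_lim_seq_const ].
    apply is_lim_seq_abs_0.
    apply is_lim_seq_le_le with (fun _ => 0) (fun n => Cmod (u n - l)%C);
      [ | apply is_lim_seq_const | exact H ].
    intros n; split; [ apply Rabs_pos | apply Hab ]. }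
  split; apply Hc; intros n.
  - apply (re_le_Cmod (u n - l)%C).
  - apply (Im_le_Cmod (u n - l)%C).
Qed.

Lemma CSeries_unique (a : nat -> C) (s : C) : is_series a s -> CSeries a = s.
Proof. intros H. apply CLim_seq_unique, is_Clim_seq_filterlim, H. Qed.

Lemma CSeries_correct (a : nat -> C) : ex_series a -> is_series a (CSeries a).
Proof. intros [s H]. now rewrite (CSeries_unique _ _ H). Qed.

(** * Differentiating along a horizontal line *)

(** The derivative of a complex function of a real variable: [C_derive G (x, y)]
    only looks at [t |-> G (t, y)], so nothing more than this is needed about
    differentiability of Gamma. *)
Definition is_derive_RC (h : R -> C) (x : R) (d : C) : Prop :=
  is_derive (fun t => Re (h t)) x (Re d) /\ is_derive (fun t => Im (h t)) x (Im d).

Lemma is_derive_RC_ext (h1 h2 : R -> C) (x : R) (d : C) :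
  (forall t, h1 t = h2 t) -> is_derive_RC h1 x d -> is_derive_RC h2 x d.
Proof.
  intros H [Hr Hi].
  split; [ eapply is_derive_ext, Hr | eapply is_derive_ext, Hi ];
    intros t; simpl; rewrite H; reflexivity.
Qed.

Lemma is_derive_RC_const (a : C) (x : R) : is_derive_RC (fun _ => a) x 0%C.
Proof. split; apply @is_derive_const. Qed.

Lemma is_derive_RC_horizontal (y x : R) : is_derive_RC (fun t => (t, y)) x 1%C.
Proof. split; simpl; [ apply @is_derive_id | apply @is_derive_const ]. Qed.

Lemma is_derive_RC_plus (h1 h2 : R -> C) (x : R) (d1 d2 : C) :
  is_derive_RC h1 x d1 -> is_derive_RC h2 x d2 ->
  is_derive_RC (fun t => h1 t + h2 t)%C x (d1 + d2)%C.
Proof. intros [] []. split; simpl; apply @is_derive_plus; assumption. Qed.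

Lemma is_derive_R_mult (f g : R -> R) (x a b : R) :
  is_derive f x a -> is_derive g x b ->
  is_derive (fun t => f t * g t) x (a * g x + f x * b).
Proof. intros. apply (is_derive_mult f g); [ assumption.. | apply Rmult_comm ]. Qed.

Lemma is_derive_RC_mult (h1 h2 : R -> C) (x : R) (d1 d2 : C) :
  is_derive_RC h1 x d1 -> is_derive_RC h2 x d2 ->
  is_derive_RC (fun t => h1 t * h2 t)%C x (d1 * h2 x + h1 x * d2)%C.
Proof.
  intros [H1 H2] [H3 H4]. split.
  - replace (Re _) with
      ((Re d1 * Re (h2 x) + Re (h1 x) * Re d2) - (Im d1 * Im (h2 x) + Im (h1 x) * Im d2))
      by (unfold Re, Im; simpl; ring).
    apply (is_derive_minus (fun t => Re (h1 t) * Re (h2 t)) (fun t => Im (h1 t) * Im (h2 t)));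
      now apply is_derive_R_mult.
  - replace (Im _) with
      ((Re d1 * Im (h2 x) + Re (h1 x) * Im d2) + (Im d1 * Re (h2 x) + Im (h1 x) * Re d2))
      by (unfold Re, Im; simpl; ring).
    apply (is_derive_plus (fun t => Re (h1 t) * Im (h2 t)) (fun t => Im (h1 t) * Re (h2 t)));
      now apply is_derive_R_mult.
Qed.

Lemma C_neq_0_norm2 (z : C) : z <> 0%C -> 0 < Re z ^ 2 + Im z ^ 2.
Proof.
  intros Hz. destruct z as [a b]; simpl.
  destruct (Req_dec a 0) as [-> | Ha]; [ destruct (Req_dec b 0) as [-> | Hb] | ].
  - now destruct Hz.
  - nra.
  - nra.
Qed.

Lemma is_derive_RC_inv (h : R -> C) (x : R) (d : C) :
  h x <> 0%C -> is_derive_RC h x d ->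
  is_derive_RC (fun t => / h t)%C x (- d / (h x * h x))%C.
Proof.
  intros Hx [H1 H2].
  assert (Hn := C_neq_0_norm2 _ Hx).
  assert (Hnd : is_derive (fun t => Re (h t) ^ 2 + Im (h t) ^ 2) x
            (2 * Re d * Re (h x) + 2 * Im d * Im (h x))).
  { apply (is_derive_plus (fun t => Re (h t) ^ 2) (fun t => Im (h t) ^ 2)).
    - evar_last; [ apply (is_derive_pow _ 2 _ _ H1) | simpl; ring ].
    - evar_last; [ apply (is_derive_pow _ 2 _ _ H2) | simpl; ring ]. }
  split; simpl.
  - evar_last; [ apply (is_derive_div (fun t => Re (h t)) _ _ _ _ H1 Hnd); lra | ].
    simpl. unfold Re, Im in *. field. simpl in Hn. nra.
  - evar_last;
      [ apply (is_derive_div (fun t => - Im (h t)) _ _ _ _ (is_derive_opp _ _ _ H2) Hnd); lra | ].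
    simpl. unfold opp; simpl. unfold Re, Im in *. field. simpl in Hn. nra.
Qed.
(** * Uniform convergence from telescoping majorants *)

Lemma telescoping_Cauchy (u : nat -> C) (K : R) (N : nat) :
  (1 <= N)%nat ->
  (forall n, (N <= n)%nat -> Cmod (u (S n) - u n)%C <= K * (/ INR n - / INR (S n))) ->
  forall n m, (N <= n)%nat -> (n <= m)%nat ->
    Cmod (u m - u n)%C <= K * (/ INR n - / INR m).
Proof.
  intros HN H n m Hn Hm. induction Hm as [ | m Hm IH ].
  - replace (u n - u n)%C with (RtoC 0) by ring. rewrite Cmod_0. lra.
  - replace (u (S m) - u n)%C with ((u (S m) - u m) + (u m - u n))%C by ring.
    eapply Rle_trans; [ apply Cmod_triangle | ].
    assert (H1 := H m ltac:(lia)). lra.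
Qed.

(** Small relative increments keep a sequence within a factor of its [N]-th
    term, which gives at once an upper bound and a positive lower bound.  The
    increments from [N] on add up to less than [K / N] times the largest term,
    and [4 * K <= INR N] is what bootstraps the estimate: as long as the terms
    stay below twice the [N]-th one, the drift is at most half of it. *)
Lemma telescoping_product (p : nat -> C) (K : R) (N : nat) :
  (1 <= N)%nat -> 0 <= K -> 4 * K <= INR N ->
  (forall n, (N <= n)%nat ->
     Cmod (p (S n) - p n)%C <= K * (/ INR n - / INR (S n)) * Cmod (p n)) ->
  forall n, (N <= n)%nat -> Cmod (p n - p N)%C <= / 2 * Cmod (p N).
Proof.
  intros HN HK HKN H.
  assert (HN0 : 0 < INR N) by (apply lt_0_INR; lia).
  assert (Hhalf : forall n, (N <= n)%nat ->
            2 * K * Cmod (p N) * (/ INR N - / INR n) <= / 2 * Cmod (p N)).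
  { intros n Hn.
    assert (0 < / INR n) by (apply Rinv_0_lt_compat, lt_0_INR; lia).
    assert (K * / INR N <= / 4).
    { apply Rmult_le_reg_r with (INR N); [ lra | ]. rewrite Rmult_assoc, Rinv_l; lra. }
    assert (0 <= Cmod (p N)) by apply Cmod_ge_0.
    assert (2 * K * (/ INR N - / INR n) <= / 2) by nra.
    nra. }
  assert (Hmain : forall n, (N <= n)%nat ->
            Cmod (p n - p N)%C <= 2 * K * Cmod (p N) * (/ INR N - / INR n)).
  { intros n Hn. induction Hn as [ | n Hn IH ].
    - replace (p N - p N)%C with (RtoC 0) by ring. rewrite Cmod_0. lra.
    - replace (p (S n) - p N)%C with ((p (S n) - p n) + (p n - p N))%C by ring.
      eapply Rle_trans; [ apply Cmod_triangle | ].
      assert (H1 := H n Hn). assert (H2 := Hhalf n Hn).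
      assert (H3 : Cmod (p n) <= 2 * Cmod (p N)).
      { replace (p n) with ((p n - p N) + p N)%C by ring.
        eapply Rle_trans; [ apply Cmod_triangle | ].
        assert (0 <= Cmod (p N)) by apply Cmod_ge_0. lra. }
      assert (H4 : / INR (S n) <= / INR n).
      { apply Rinv_le_contravar; [ apply lt_0_INR; lia | apply le_INR; lia ]. }
      assert (0 <= K * (/ INR n - / INR (S n))) by (apply Rmult_le_pos; lra).
      nra. }
  intros n Hn. eapply Rle_trans; [ apply Hmain | apply Hhalf ]; exact Hn.
Qed.

(** The tail of the majorant telescopes to at most [K / n], which does not depend
    on [x]. *)
Lemma telescoping_CVU (u : nat -> R -> C) (D : R -> Prop) (K : R) (N : nat) :
  (1 <= N)%nat -> 0 <= K ->
  (forall n x, (N <= n)%nat -> D x ->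
     Cmod (u (S n) x - u n x)%C <= K * (/ INR n - / INR (S n))) ->
  CVU_cauchy (fun n x => Re (u n x)) D /\ CVU_cauchy (fun n x => Im (u n x)) D.
Proof.
  intros HN HK H.
  assert (Hc : forall eps : posreal, exists M, forall n m x, D x ->
            (M <= n)%nat -> (M <= m)%nat -> Cmod (u n x - u m x)%C < eps).
  { intros eps.
    destruct (nfloor_ex (K / eps)) as [M0 [_ HM0]].
    { apply Rdiv_le_0_compat; [ exact HK | apply cond_pos ]. }
    exists (N + S M0)%nat.
    assert (Haux : forall n m x, D x -> (N + S M0 <= n)%nat -> (n <= m)%nat ->
              Cmod (u m x - u n x)%C < eps).
    { intros n m x Hx Hn Hm.
      eapply Rle_lt_trans;
        [ apply (telescoping_Cauchy (fun n => u n x) K N);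
          [ exact HN | intros; now apply H | lia | exact Hm ] | ].
      assert (Hn0 : 0 < INR n) by (apply lt_0_INR; lia).
      assert (Hm0 : 0 < / INR m) by (apply Rinv_0_lt_compat, lt_0_INR; lia).
      assert (HKn : K / eps < INR n).
      { eapply Rlt_le_trans; [ exact HM0 | ]. rewrite <- S_INR. apply le_INR; lia. }
      assert (He := cond_pos eps).
      assert (K < INR n * eps).
      { apply Rmult_lt_reg_r with (/ eps); [ now apply Rinv_0_lt_compat | ].
        rewrite Rmult_assoc, Rinv_r; lra. }
      assert (K * / INR n < eps).
      { apply Rmult_lt_reg_r with (INR n); [ exact Hn0 | ].
        rewrite Rmult_assoc, Rinv_l; lra. }
      nra. }
    intros n m x Hx Hn Hm. destruct (Nat.le_ge_cases n m) as [Hnm | Hnm].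
    - rewrite Cmod_minus_sym. now apply Haux.
    - now apply Haux. }
  split; intros eps; destruct (Hc eps) as [M HM]; exists M; intros n m x Hx Hn Hm.
  - eapply Rle_lt_trans; [ apply (re_le_Cmod (u n x - u m x)%C) | now apply HM ].
  - eapply Rle_lt_trans; [ apply (Im_le_Cmod (u n x - u m x)%C) | now apply HM ].
Qed.

Lemma CVU_cauchy_is_lim_seq (v : nat -> R -> R) (D : R -> Prop) (x : R) :
  CVU_cauchy v D -> D x -> is_lim_seq (fun n => v n x) (real (Lim_seq (fun n => v n x))).
Proof.
  intros H Hx.
  apply Lim_seq_correct', ex_lim_seq_cauchy_corr.
  intros eps. destruct (H eps) as [M HM]. exists M. intros n m Hn Hm. now apply HM.
Qed.

(** The second differentiability hypothesis is there to make the derivatives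
    [dv n] continuous, as differentiation under a uniform limit requires. *)
Lemma CVU_cauchy_is_derive (v dv : nat -> R -> R) (x0 delta : R) :
  0 < delta ->
  let D := fun x => Rabs (x - x0) < delta in
  (forall n x, D x -> is_derive (v n) x (dv n x)) ->
  (forall n x, D x -> ex_derive (dv n) x) ->
  CVU_cauchy v D -> CVU_cauchy dv D ->
  is_derive (fun x => real (Lim_seq (fun n => v n x))) x0
            (real (Lim_seq (fun n => dv n x0))).
Proof.
  intros Hd D Hv Hdv Cv Cdv.
  assert (HDx0 : D x0).
  { unfold D. rewrite Rminus_diag, Rabs_R0. exact Hd. }
  assert (HD : open D).
  { intros x Hx. exists (mkposreal (delta - Rabs (x - x0)) ltac:(unfold D in Hx; lra)).
    intros y Hy. change (Rabs (y - x) < delta - Rabs (x - x0)) in Hy. unfold D.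
    replace (y - x0) with ((y - x) + (x - x0)) by ring.
    eapply Rle_lt_trans; [ apply Rabs_triang | lra ]. }
  assert (Hder : forall n x, D x -> Derive (v n) x = dv n x).
  { intros n x Hx. now apply is_derive_unique, Hv. }
  rewrite <- (Lim_seq_ext (fun n => Derive (v n) x0)) by (intros n; now apply Hder).
  apply (CVU_Derive v D); try assumption.
  - intros a b z Ha Hb Hz. unfold D in *. apply Rabs_def2 in Ha. apply Rabs_def2 in Hb.
    apply Rabs_def1; lra.
  - now apply CVU_dom_cauchy.
  - intros n x Hx. exists (dv n x). now apply Hv.
  - intros n x Hx. apply continuity_pt_filterlim.
    apply (continuous_ext_loc (U := R_UniformSpace) (Derive (v n)) (dv n) x).
    + destruct (HD x Hx) as [eps He]. exists eps. intros y Hy.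
      symmetry. apply Hder, He, Hy.
    + apply (ex_derive_continuous (dv n)). now apply Hdv.
  - apply CVU_dom_cauchy. intros eps. destruct (Cdv eps) as [M HM].
    exists M. intros n m x Hx Hn Hm. rewrite !Hder by assumption. now apply HM.
Qed.

Lemma telescoping_is_derive_RC (p dp : nat -> R -> C) (x0 delta K : R) (N : nat) :
  0 < delta -> (1 <= N)%nat -> 0 <= K ->
  (forall n x, Rabs (x - x0) < delta -> is_derive_RC (p n) x (dp n x)) ->
  (forall n x, Rabs (x - x0) < delta -> exists d, is_derive_RC (dp n) x d) ->
  (forall n x, (N <= n)%nat -> Rabs (x - x0) < delta ->
     Cmod (p (S n) x - p n x)%C <= K * (/ INR n - / INR (S n))) ->
  (forall n x, (N <= n)%nat -> Rabs (x - x0) < delta ->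
     Cmod (dp (S n) x - dp n x)%C <= K * (/ INR n - / INR (S n))) ->
  is_Clim_seq (fun n => p n x0) (CLim_seq (fun n => p n x0)) /\
  is_Clim_seq (fun n => dp n x0) (CLim_seq (fun n => dp n x0)) /\
  is_derive_RC (fun x => CLim_seq (fun n => p n x)) x0 (CLim_seq (fun n => dp n x0)).
Proof.
  intros Hd HN HK Hp Hdp Bp Bdp.
  assert (Hx0 : Rabs (x0 - x0) < delta) by (rewrite Rminus_diag, Rabs_R0; exact Hd).
  destruct (telescoping_CVU p (fun x => Rabs (x - x0) < delta) K N HN HK Bp) as [C1 C2].
  destruct (telescoping_CVU dp (fun x => Rabs (x - x0) < delta) K N HN HK Bdp) as [C3 C4].
  split; [ | split ].
  - split; [ now apply (CVU_cauchy_is_lim_seq _ _ x0 C1)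
           | now apply (CVU_cauchy_is_lim_seq _ _ x0 C2) ].
  - split; [ now apply (CVU_cauchy_is_lim_seq _ _ x0 C3)
           | now apply (CVU_cauchy_is_lim_seq _ _ x0 C4) ].
  - split.
    + apply (CVU_cauchy_is_derive (fun n x => Re (p n x)) (fun n x => Re (dp n x))
               x0 delta); try assumption; intros n x Hx; [ apply (Hp n x Hx) | ].
      destruct (Hdp n x Hx) as [d Hdd]. exists (Re d). apply Hdd.
    + apply (CVU_cauchy_is_derive (fun n x => Im (p n x)) (fun n x => Im (dp n x))
               x0 delta); try assumption; intros n x Hx; [ apply (Hp n x Hx) | ].
      destruct (Hdp n x Hx) as [d Hdd]. exists (Im d). apply Hdd.
Qed.
(** * The complex exponential near 0 *)

Lemma exp_minus_1_bound (a : R) : Rabs a <= / 2 -> 0 <= exp a - 1 - a <= 2 * a ^ 2.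
Proof.
  intros Ha. apply Rabs_le_between in Ha.
  assert (H1 := exp_ineq1_le a). assert (H2 := exp_ineq1_le (- a)).
  split; [ lra | ].
  (* The upper bound comes from [exp (- a) >= 1 - a] by taking inverses. *)
  assert (H3 : exp a * exp (- a) = 1).
  { rewrite <- exp_plus. replace (a + - a) with 0 by ring. apply exp_0. }
  assert (H4 := exp_pos a).
  assert (exp a * (1 - a) <= 1) by nra.
  nra.
Qed.

Lemma one_minus_cos_bound (b : R) : 0 <= 1 - cos b <= b ^ 2 / 2.
Proof.
  assert (Hs2 : sin (b / 2) ^ 2 <= (b / 2) ^ 2).
  { destruct (MVT_gen sin 0 (b / 2) cos) as [c [_ H]].
    - intros t _. apply is_derive_sin.
    - intros t _. apply continuity_sin.
    - rewrite sin_0 in H. replace (sin (b / 2)) with (cos c * (b / 2)) by lra.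
      assert (H1 := COS_bound c).
      assert (cos c ^ 2 <= 1) by nra. rewrite Rpow_mult_distr.
      assert (0 <= (b / 2) ^ 2) by apply pow2_ge_0. nra. }
  replace b with (2 * (b / 2)) at 1 2 by field.
  rewrite cos_2a_sin.
  assert (0 <= sin (b / 2) ^ 2) by apply pow2_ge_0.
  simpl in *. split; lra.
Qed.

Lemma sin_minus_id_bound (b : R) : Rabs (sin b - b) <= Rabs b * (b ^ 2 / 2).
Proof.
  destruct (MVT_gen (fun t => sin t - t) 0 b (fun t => cos t - 1)) as [c [Hc H]].
  - intros t _. auto_derive; [ exact I | ring ].
  - intros t _.
    apply continuity_pt_minus; [ apply continuity_sin | apply continuity_pt_id ].
  - rewrite sin_0 in H. replace (sin b - b) with ((cos c - 1) * (b - 0)) by lra.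
    rewrite Rabs_mult, Rmult_comm, Rminus_0_r.
    apply Rmult_le_compat_l; [ apply Rabs_pos | ].
    assert (H1 := one_minus_cos_bound c).
    rewrite Rabs_left1 by lra.
    assert (c ^ 2 <= b ^ 2); [ | lra ].
    revert Hc. unfold Rmin, Rmax. destruct (Rle_dec 0 b); intros; nra.
Qed.

Lemma Cexp_bound (w : C) :
  Cmod w <= / 2 -> Cmod (Cexp w - 1 - w)%C <= 5 * Cmod w ^ 2.
Proof.
  intros Hw.
  assert (Ha := re_le_Cmod w). assert (Hb := Im_le_Cmod w).
  assert (Hn : Cmod w ^ 2 = Re w ^ 2 + Im w ^ 2).
  { unfold Cmod. rewrite pow2_sqrt; [ reflexivity | ].
    apply Rplus_le_le_0_compat; apply pow2_ge_0. }
  set (a := Re w) in *. set (b := Im w) in *.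
  assert (He := exp_minus_1_bound a ltac:(lra)).
  assert (Hc := one_minus_cos_bound b).
  assert (Hs := sin_minus_id_bound b).
  assert (Hs1 : Rabs (sin b - b) <= b ^ 2).
  { eapply Rle_trans; [ exact Hs | ].
    assert (0 <= b ^ 2) by apply pow2_ge_0. nra. }
  assert (Ha2 : Rabs a * Rabs a = a ^ 2) by (rewrite <- Rabs_mult, Rabs_pos_eq; [ ring | nra ]).
  assert (Hb2 : Rabs b * Rabs b = b ^ 2) by (rewrite <- Rabs_mult, Rabs_pos_eq; [ ring | nra ]).
  assert (Ha0 := Rabs_pos a). assert (Hb0 := Rabs_pos b).
  assert (Hal := Rle_abs a).
  eapply Rle_trans; [ apply Cmod_le_Re_Im | ]. rewrite Hn.
  replace (Re (Cexp w - 1 - w)%C) with ((exp a - 1 - a) - exp a * (1 - cos b))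
    by (unfold a, b, Re, Im; simpl; unfold Re, Im; ring).
  replace (Im (Cexp w - 1 - w)%C) with ((exp a - 1 - a) * sin b + a * sin b + (sin b - b))
    by (unfold a, b, Re, Im; simpl; unfold Re, Im; ring).
  assert (H1 : Rabs ((exp a - 1 - a) - exp a * (1 - cos b)) <= 2 * a ^ 2 + b ^ 2).
  { assert (exp a <= 2) by nra. assert (0 < exp a) by apply exp_pos.
    apply Rabs_le. split; nra. }
  assert (Hsb : Rabs (sin b) <= Rabs b + b ^ 2).
  { replace (sin b) with (b + (sin b - b)) by ring.
    eapply Rle_trans; [ apply Rabs_triang | lra ]. }
  assert (H2 : Rabs ((exp a - 1 - a) * sin b + a * sin b + (sin b - b))
               <= 3 * a ^ 2 + 2 * b ^ 2).
  { assert (Rabs ((exp a - 1 - a) * sin b) <= 2 * a ^ 2 * 1).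
    { rewrite Rabs_mult. apply Rmult_le_compat; try apply Rabs_pos.
      - rewrite Rabs_pos_eq; lra.
      - apply Rabs_le. apply SIN_bound. }
    eapply Rle_trans; [ apply Rabs_triang | ].
    eapply Rle_trans; [ apply Rplus_le_compat_r, Rabs_triang | ].
    rewrite (Rabs_mult a).
    assert (Rabs a * Rabs (sin b) <= Rabs a * (Rabs b + b ^ 2))
      by (apply Rmult_le_compat_l; assumption).
    assert (Rabs a * b ^ 2 <= / 2 * b ^ 2).
    { apply Rmult_le_compat_r; [ apply pow2_ge_0 | lra ]. }
    assert (2 * (Rabs a * Rabs b) <= a ^ 2 + b ^ 2).
    { rewrite <- Ha2, <- Hb2. assert (0 <= (Rabs a - Rabs b) ^ 2) by apply pow2_ge_0. lra. }
    lra. }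
  assert (0 <= a ^ 2) by apply pow2_ge_0. assert (0 <= b ^ 2) by apply pow2_ge_0. lra.
Qed.
(** * Euler products for Gamma *)

Lemma ln_succ_bounds (n : nat) :
  (1 <= n)%nat -> / INR (S n) <= ln (INR (S n)) - ln (INR n) <= / INR n.
Proof.
  intros Hn.
  assert (Hn0 : 0 < INR n) by (apply lt_0_INR; lia).
  assert (Hl : forall x y, 0 < x -> 0 < y -> ln x - ln y <= x / y - 1).
  { intros x y Hx Hy. rewrite <- ln_div by assumption.
    assert (H := exp_ineq1_le (ln (x / y))).
    rewrite exp_ln in H by (apply Rdiv_lt_0_compat; assumption). lra. }
  rewrite S_INR.
  assert (H1 := Hl (INR n + 1) (INR n) ltac:(lra) Hn0).
  assert (H2 := Hl (INR n) (INR n + 1) Hn0 ltac:(lra)).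
  replace ((INR n + 1) / INR n - 1) with (/ INR n) in H1 by (field; lra).
  replace (INR n / (INR n + 1) - 1) with (- / (INR n + 1)) in H2 by (field; lra).
  lra.
Qed.

Lemma Cexp_plus (z w : C) : Cexp (z + w)%C = (Cexp z * Cexp w)%C.
Proof.
  apply C_eq; unfold Cexp, Re, Im; simpl; unfold Re, Im;
    rewrite exp_plus, ?cos_plus, ?sin_plus; ring.
Qed.

Lemma Cmod_Cexp (z : C) : Cmod (Cexp z) = exp (Re z).
Proof.
  unfold Cmod, Cexp; simpl.
  replace (_ + _) with (exp (Re z) ^ 2 * (sin (Im z) ^ 2 + cos (Im z) ^ 2)) by ring.
  rewrite <- !Rsqr_pow2, sin2_cos2, Rmult_1_r, Rsqr_pow2.
  apply sqrt_pow2. left; apply exp_pos.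
Qed.

Lemma Cexp_neq_0 (z : C) : Cexp z <> 0%C.
Proof.
  intros H. assert (H1 := Cmod_Cexp z). rewrite H, Cmod_0 in H1.
  assert (H2 := exp_pos (Re z)). lra.
Qed.

(** The terms of Gauss' sequence for [Gamma z]; [euler_logder n] is the
    logarithmic derivative of [euler_product n]. *)
Definition euler_product (n : nat) (z : C) : C :=
  (RtoC (INR (fact n)) * nat_Cpower n z / rising z n)%C.

Definition euler_logder (n : nat) (z : C) : C :=
  (RtoC (ln (INR n)) - sum_n (fun j => / (z + RtoC (INR j))) n)%C.

Lemma RtoC_neq_0 (r : R) : r <> 0 -> RtoC r <> 0%C.
Proof. intros H E. apply H. exact (f_equal Re E). Qed.

Lemma Cinv_neq_0 (z : C) : z <> 0%C -> (/ z)%C <> 0%C.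
Proof.
  intros H E. apply C1_nz. rewrite <- (Cinv_r z H), E. ring.
Qed.

Lemma rising_S (z : C) (n : nat) :
  rising z (S n) = (rising z n * (z + RtoC (INR (S n))))%C.
Proof. reflexivity. Qed.

Lemma rising_neq_0 (z : C) (n : nat) :
  (forall j, (z + RtoC (INR j))%C <> 0%C) -> rising z n <> 0%C.
Proof.
  intros H. induction n as [ | n IH ].
  - specialize (H 0%nat). simpl in *. now rewrite Cplus_0_r in H.
  - rewrite rising_S. apply Cmult_neq_0; [ exact IH | apply H ].
Qed.

Lemma euler_product_neq_0 (z : C) (n : nat) :
  (forall j, (z + RtoC (INR j))%C <> 0%C) -> euler_product n z <> 0%C.
Proof.
  intros H. unfold euler_product, Cdiv.
  repeat apply Cmult_neq_0.
  - apply RtoC_neq_0, INR_fact_neq_0.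
  - apply Cexp_neq_0.
  - now apply Cinv_neq_0, rising_neq_0.
Qed.

Lemma is_derive_RC_nat_Cpower (n : nat) (x y : R) :
  is_derive_RC (fun t => nat_Cpower n (t, y)) x
    (nat_Cpower n (x, y) * RtoC (ln (INR n)))%C.
Proof.
  split; unfold nat_Cpower, Cexp, Re, Im; simpl; unfold Re, Im; simpl;
    auto_derive; trivial; unfold Rminus; ring.
Qed.

Lemma is_derive_RC_rising (n : nat) (x y : R) :
  (forall j, ((x, y) + RtoC (INR j))%C <> 0%C) ->
  is_derive_RC (fun t => rising (t, y) n) x
    (rising (x, y) n * sum_n (fun j => / ((x, y) + RtoC (INR j))) n)%C.
Proof.
  intros H. induction n as [ | n IH ].
  - rewrite sum_O.
    replace (rising (x, y) 0 * _)%C with (RtoC 1); [ apply is_derive_RC_horizontal | ].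
    specialize (H 0%nat). simpl rising. simpl INR in *. field_simplify_eq; [ ring | ].
    rewrite Cplus_0_r in *. exact H.
  - rewrite sum_Sn.
    replace (rising (x, y) (S n) * _)%C with
      (rising (x, y) n * sum_n (fun j => / ((x, y) + RtoC (INR j))) n
         * ((x, y) + RtoC (INR (S n))) + rising (x, y) n * (1 + 0))%C.
    + apply (is_derive_RC_mult (fun t => rising (t, y) n)
               (fun t => (t, y) + RtoC (INR (S n)))%C); [ exact IH | ].
      apply (is_derive_RC_plus (fun t => (t, y)) (fun _ => RtoC (INR (S n)))).
      * apply is_derive_RC_horizontal.
      * apply is_derive_RC_const.
    + rewrite rising_S. unfold plus; simpl plus. specialize (H (S n)).
      set (w := ((x, y) + RtoC (INR (S n)))%C) in *.
      match goal with |- context [sum_n ?a n] => set (s := sum_n a n) end.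
      change (AbelianMonoid.sort _) with C in s.
      change (rising (x, y) n * s * w + rising (x, y) n * (1 + 0) =
              rising (x, y) n * w * (s + / w))%C.
      field. exact H.
Qed.

Lemma is_derive_RC_euler_product (n : nat) (x y : R) :
  (forall j, ((x, y) + RtoC (INR j))%C <> 0%C) ->
  is_derive_RC (fun t => euler_product n (t, y)) x
    (euler_product n (x, y) * euler_logder n (x, y))%C.
Proof.
  intros H.
  assert (Hr := rising_neq_0 _ n H).
  assert (H1 := is_derive_RC_mult _ _ _ _ _
            (is_derive_RC_mult _ _ _ _ _
               (is_derive_RC_const (RtoC (INR (fact n))) x)
               (is_derive_RC_nat_Cpower n x y))
            (is_derive_RC_inv _ _ _ Hr (is_derive_RC_rising n x y H))).
  unfold euler_product, euler_logder, Cdiv.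
  match goal with |- context [sum_n ?a n] => set (s := sum_n a n) in * end.
  replace (_ * _ * / rising (x, y) n * _)%C with
    ((0 * nat_Cpower n (x, y) +
      RtoC (INR (fact n)) * (nat_Cpower n (x, y) * RtoC (ln (INR n)))) * / rising (x, y) n
     + RtoC (INR (fact n)) * nat_Cpower n (x, y) *
       (- (rising (x, y) n * s) / (rising (x, y) n * rising (x, y) n)))%C.
  - exact H1.
  - field. exact Hr.
Qed.

Lemma ex_derive_RC_euler_logder (n : nat) (x y : R) :
  (forall j, ((x, y) + RtoC (INR j))%C <> 0%C) ->
  exists d, is_derive_RC (fun t => euler_logder n (t, y)) x d.
Proof.
  intros H.
  assert (Hs : forall N, exists d,
            is_derive_RC (fun t => sum_n (fun j => / ((t, y) + RtoC (INR j)))%C N) x d).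
  { assert (Hj : forall j, exists d,
              is_derive_RC (fun t => / ((t, y) + RtoC (INR j)))%C x d).
    { intros j. eexists. apply is_derive_RC_inv; [ apply H | ].
      apply (is_derive_RC_plus (fun t => (t, y)) (fun _ => RtoC (INR j)));
        [ apply is_derive_RC_horizontal | apply is_derive_RC_const ]. }
    intros N. induction N as [ | N [d IH] ].
    - destruct (Hj 0%nat) as [d Hd]. exists d.
      eapply is_derive_RC_ext, Hd. intros t. now rewrite sum_O.
    - destruct (Hj (S N)) as [e He]. exists (d + e)%C.
      eapply is_derive_RC_ext; [ | apply (is_derive_RC_plus _ _ _ _ _ IH He) ].
      intros t. now rewrite sum_Sn. }
  destruct (Hs n) as [d Hd]. exists (0 + (0 * sum_n (fun j => / ((x, y) + RtoC (INR j))) n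
                                     + - (1) * d))%C.
  eapply is_derive_RC_ext;
    [ | apply (is_derive_RC_plus _ _ _ _ _ (is_derive_RC_const (RtoC (ln (INR n))) x)
                (is_derive_RC_mult _ _ _ _ _ (is_derive_RC_const (- (1))%C x) Hd)) ].
  intros t. unfold euler_logder. simpl. ring.
Qed.
(** * Gauss' limit and the digamma function *)

Lemma Cmod_plus_INR_ge (z : C) (R0 : R) (n : nat) :
  Cmod z <= R0 -> 2 * R0 <= INR n -> INR n / 2 <= Cmod (z + RtoC (INR n))%C.
Proof.
  intros Hz Hn.
  assert (H : Cmod (RtoC (INR n)) <= Cmod (z + RtoC (INR n))%C + Cmod (- z)%C).
  { replace (RtoC (INR n)) with ((z + RtoC (INR n)) + - z)%C at 1 by ring.
    apply Cmod_triangle. }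
  rewrite Cmod_opp, Cmod_R, Rabs_pos_eq in H by apply pos_INR. lra.
Qed.

Lemma nat_Cpower_S (n : nat) (z : C) :
  nat_Cpower (S n) z =
  (nat_Cpower n z * Cexp (z * RtoC (ln (INR (S n)) - ln (INR n))))%C.
Proof.
  unfold nat_Cpower. rewrite <- Cexp_plus. f_equal. rewrite RtoC_minus. ring.
Qed.

(** With [d = ln (n+1) - ln n], the quotient of consecutive products is
    [exp (z d) (n+1) / (z + n + 1)].  Its distance to 1 is, up to the bounded
    factor [(n+1) / (z + n + 1)], that of [exp (z d)] to [1 + z / (n+1)]: the
    second order error of the exponential plus [z (d - 1 / (n+1))], both of
    order [1 / n^2]. *)
Lemma euler_product_step (z : C) (R0 : R) (n : nat) :
  (1 <= n)%nat -> 2 * R0 <= INR n -> Cmod z <= R0 ->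
  (forall j, (z + RtoC (INR j))%C <> 0%C) ->
  Cmod (euler_product (S n) z - euler_product n z)%C <=
  (20 * R0 ^ 2 + 2 * R0) * (/ INR n - / INR (S n)) * Cmod (euler_product n z).
Proof.
  intros Hn HR Hz H.
  assert (HR0 : 0 <= R0) by (eapply Rle_trans; [ apply Cmod_ge_0 | exact Hz ]).
  assert (Hn0 : 1 <= INR n) by (apply (le_INR 1); lia).
  assert (HSn : INR (S n) = INR n + 1) by apply S_INR.
  assert (Hd := ln_succ_bounds n Hn).
  set (d := ln (INR (S n)) - ln (INR n)) in *.
  set (w := (z + RtoC (INR (S n)))%C).
  assert (Hw0 : w <> 0%C) by apply H.
  assert (Hwge : INR (S n) / 2 <= Cmod w) by (apply (Cmod_plus_INR_ge z R0); lra).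
  assert (HwS : RtoC (INR (S n)) <> 0%C) by (apply RtoC_neq_0; lra).
  assert (E : (euler_product (S n) z - euler_product n z)%C =
    (euler_product n z * (RtoC (INR (S n)) / w) *
       ((Cexp (z * RtoC d) - 1 - z * RtoC d) + z * RtoC (d - / INR (S n))))%C).
  { unfold euler_product. rewrite rising_S, nat_Cpower_S, fact_simpl, mult_INR.
    fold d. fold w. rewrite RtoC_minus, RtoC_mult, RtoC_inv by lra.
    unfold w in *. field. repeat split; try assumption. now apply rising_neq_0. }
  rewrite E, !Cmod_mult, Cmod_div, Cmod_R, (Rabs_pos_eq (INR (S n))) by (assumption || lra).
  assert (Hq : INR (S n) / Cmod w <= 2).
  { apply Rmult_le_reg_r with (Cmod w); [ lra | ].
    unfold Rdiv. rewrite Rmult_assoc, Rinv_l; lra. }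
  assert (Hq0 : 0 <= INR (S n) / Cmod w) by (apply Rdiv_le_0_compat; lra).
  assert (Hi : / INR n - / INR (S n) = / INR n * / INR (S n)).
  { rewrite HSn. field. lra. }
  assert (Hin : 0 < / INR n) by (apply Rinv_0_lt_compat; lra).
  assert (HiS : 0 < / INR (S n)) by (apply Rinv_0_lt_compat; lra).
  assert (Hi2 : / INR n * / INR n <= 2 * (/ INR n * / INR (S n))).
  { assert (/ INR n <= 2 * / INR (S n)); [ | nra ].
    rewrite HSn. apply Rmult_le_reg_r with (INR n * (INR n + 1)); [ nra | ].
    field_simplify; lra. }
  assert (Hzd : Cmod (z * RtoC d)%C <= R0 * / INR n).
  { rewrite Cmod_mult, Cmod_R, Rabs_pos_eq by lra.
    apply Rmult_le_compat; try lra. apply Cmod_ge_0. }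
  assert (Hzd2 : R0 * / INR n <= / 2).
  { apply Rmult_le_reg_r with (INR n); [ lra | ]. rewrite Rmult_assoc, Rinv_l; lra. }
  assert (Hexp : Cmod (Cexp (z * RtoC d) - 1 - z * RtoC d)%C
                 <= 10 * R0 ^ 2 * (/ INR n * / INR (S n))).
  { eapply Rle_trans; [ apply Cexp_bound; lra | ].
    assert (Cmod (z * RtoC d)%C ^ 2 <= (R0 * / INR n) ^ 2)
      by (apply pow_incr; split; [ apply Cmod_ge_0 | exact Hzd ]).
    assert (0 <= R0 ^ 2) by apply pow2_ge_0.
    nra. }
  assert (Hlin : Cmod (z * RtoC (d - / INR (S n)))%C <= R0 * (/ INR n * / INR (S n))).
  { rewrite Cmod_mult, Cmod_R, Rabs_pos_eq by lra.
    apply Rmult_le_compat; try lra. apply Cmod_ge_0. }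
  assert (Ht := Cmod_triangle (Cexp (z * RtoC d) - 1 - z * RtoC d)%C
                              (z * RtoC (d - / INR (S n)))%C).
  assert (HP := Cmod_ge_0 (euler_product n z)).
  set (P := Cmod (euler_product n z)) in *.
  set (X := Cmod (Cexp (z * RtoC d) - 1 - z * RtoC d + z * RtoC (d - / INR (S n)))%C) in *.
  assert (HX0 : 0 <= X) by apply Cmod_ge_0.
  rewrite Hi.
  assert (HX : X <= (10 * R0 ^ 2 + R0) * (/ INR n * / INR (S n))) by lra.
  replace (P * (INR (S n) / Cmod w) * X) with (P * ((INR (S n) / Cmod w) * X)) by ring.
  rewrite (Rmult_comm _ P). apply Rmult_le_compat_l; [ exact HP | ].
  apply Rle_trans with (2 * X); [ now apply Rmult_le_compat_r | lra ].
Qed.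

Lemma euler_logder_step (z : C) (R0 : R) (n : nat) :
  (1 <= n)%nat -> 2 * R0 <= INR n -> Cmod z <= R0 ->
  (forall j, (z + RtoC (INR j))%C <> 0%C) ->
  Cmod (euler_logder (S n) z - euler_logder n z)%C <=
  (1 + 2 * R0) * (/ INR n - / INR (S n)).
Proof.
  intros Hn HR Hz H.
  assert (HR0 : 0 <= R0) by (eapply Rle_trans; [ apply Cmod_ge_0 | exact Hz ]).
  assert (Hn0 : 1 <= INR n) by (apply (le_INR 1); lia).
  assert (HSn : INR (S n) = INR n + 1) by apply S_INR.
  assert (Hd := ln_succ_bounds n Hn).
  assert (Hw0 := H (S n)).
  assert (Hwge : INR (S n) / 2 <= Cmod (z + RtoC (INR (S n)))%C)
    by (apply (Cmod_plus_INR_ge z R0); lra).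
  assert (HwS : RtoC (INR (S n)) <> 0%C) by (apply RtoC_neq_0; lra).
  assert (E : (euler_logder (S n) z - euler_logder n z)%C =
    (RtoC (ln (INR (S n)) - ln (INR n) - / INR (S n)) +
       z / (RtoC (INR (S n)) * (z + RtoC (INR (S n)))))%C).
  { unfold euler_logder. rewrite sum_Sn.
    match goal with |- context [sum_n ?a n] => set (s := sum_n a n) end.
    change (AbelianMonoid.sort _) with C in s.
    change (plus s (/ (z + RtoC (INR (S n)))))%C with (s + / (z + RtoC (INR (S n))))%C.
    rewrite !RtoC_minus, RtoC_inv by lra. field. split; assumption. }
  rewrite E. eapply Rle_trans; [ apply Cmod_triangle | ].
  assert (Hi : / INR n - / INR (S n) = / INR n * / INR (S n)).
  { rewrite HSn. field. lra. }
  assert (Hin : 0 < / INR n) by (apply Rinv_0_lt_compat; lra).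
  assert (HiS : 0 < / INR (S n)) by (apply Rinv_0_lt_compat; lra).
  assert (H1 : Cmod (RtoC (ln (INR (S n)) - ln (INR n) - / INR (S n)))
               <= / INR n - / INR (S n)).
  { rewrite Cmod_R, Rabs_pos_eq by lra. lra. }
  assert (H2 : Cmod (z / (RtoC (INR (S n)) * (z + RtoC (INR (S n)))))%C
               <= 2 * R0 * (/ INR n - / INR (S n))).
  { rewrite Cmod_div by (now apply Cmult_neq_0).
    rewrite Cmod_mult, Cmod_R, Rabs_pos_eq by lra.
    assert (Hwi : / Cmod (z + RtoC (INR (S n)))%C <= 2 * / INR (S n)).
    { replace (2 * / INR (S n)) with (/ (INR (S n) / 2)) by (field; lra).
      apply Rinv_le_contravar; lra. }
    assert (/ INR (S n) <= / INR n) by (apply Rinv_le_contravar; lra).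
    assert (0 < / Cmod (z + RtoC (INR (S n)))%C) by (apply Rinv_0_lt_compat; lra).
    unfold Rdiv. rewrite Rinv_mult, Hi.
    apply Rle_trans with (R0 * (/ INR (S n) * (2 * / INR (S n)))).
    - apply Rmult_le_compat; [ apply Cmod_ge_0 | | exact Hz | ].
      + apply Rmult_le_pos; lra.
      + apply Rmult_le_compat_l; lra.
    - replace (2 * R0 * (/ INR n * / INR (S n)))
        with (R0 * (/ INR (S n) * (2 * / INR n))) by ring.
      apply Rmult_le_compat_l; [ exact HR0 | ].
      apply Rmult_le_compat_l; lra. }
  lra.
Qed.
Lemma exists_nat_ge (r : R) : exists n, (1 <= n)%nat /\ r <= INR n.
Proof.
  destruct (nfloor_ex (Rmax 0 r)) as [n [_ Hn]]; [ apply Rmax_l | ].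
  exists (S n). split; [ lia | ]. rewrite S_INR. assert (H := Rmax_r 0 r). lra.
Qed.

(** The points [z + j] leave every bounded set, so only finitely many of them
    decide the distance to 0. *)
Lemma poles_at_positive_distance (z : C) :
  (forall j, (z + RtoC (INR j))%C <> 0%C) ->
  exists delta, 0 < delta /\ forall j, 2 * delta <= Cmod (z + RtoC (INR j))%C.
Proof.
  intros H.
  destruct (exists_nat_ge (2 * Cmod z)) as [J [HJ1 HJ]].
  assert (Hfin : forall m, exists delta, 0 < delta /\
            forall j, (j < m)%nat -> 2 * delta <= Cmod (z + RtoC (INR j))%C).
  { induction m as [ | m [d [Hd IH]] ].
    - exists 1. split; [ lra | lia ].
    - assert (Hm := proj1 (Cmod_gt_0 _) (H m)).
      exists (Rmin d (Cmod (z + RtoC (INR m))%C / 2)). split.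
      + apply Rmin_glb_lt; lra.
      + intros j Hj. destruct (Nat.eq_dec j m) as [-> | Hne].
        * assert (H1 := Rmin_r d (Cmod (z + RtoC (INR m))%C / 2)). lra.
        * assert (H1 := Rmin_l d (Cmod (z + RtoC (INR m))%C / 2)).
          specialize (IH j ltac:(lia)). lra. }
  destruct (Hfin J) as [d [Hd Hj]].
  exists (Rmin d (/ 4)). split; [ apply Rmin_glb_lt; lra | ].
  intros j. destruct (Nat.lt_ge_cases j J) as [Hlt | Hge].
  - assert (H1 := Rmin_l d (/ 4)). specialize (Hj j Hlt). lra.
  - assert (H1 := Rmin_r d (/ 4)).
    assert (H2 : INR J <= INR j) by now apply le_INR.
    assert (H3 : 1 <= INR J) by now apply (le_INR 1).
    assert (H4 := Cmod_plus_INR_ge z (Cmod z) j ltac:(lra) ltac:(lra)). lra.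
Qed.

Lemma Cmod_sum_n_le (a : nat -> C) (b : nat -> R) (n : nat) :
  (forall j, Cmod (a j) <= b j) -> Cmod (sum_n a n) <= sum_n b n.
Proof.
  intros H. induction n as [ | n IH ].
  - now rewrite !sum_O.
  - rewrite !sum_Sn. eapply Rle_trans; [ apply Cmod_triangle | ].
    apply Rplus_le_compat; [ exact IH | apply H ].
Qed.

Lemma exp_le (x y : R) : x <= y -> exp x <= exp y.
Proof. intros [H | ->]; [ left; now apply exp_increasing | apply Rle_refl ]. Qed.

Lemma euler_product_bound (z : C) (R0 delta : R) (N : nat) :
  (1 <= N)%nat -> 0 < delta -> Cmod z <= R0 ->
  (forall j, delta <= Cmod (z + RtoC (INR j))%C) ->
  Cmod (euler_product N z) <= INR (fact N) * exp (R0 * ln (INR N)) / delta ^ S N.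
Proof.
  intros HN Hd HR H.
  assert (Hr : forall n, delta ^ S n <= Cmod (rising z n)).
  { induction n as [ | n IH ].
    - specialize (H 0%nat). simpl in *. rewrite Cplus_0_r in H. lra.
    - rewrite rising_S, Cmod_mult, (Rmult_comm (Cmod _)).
      apply (Rmult_le_compat delta _ (delta ^ S n)); [ lra | apply pow_le; lra | apply H | exact IH ]. }
  assert (Hpos : 0 < delta ^ S N) by now apply pow_lt.
  specialize (Hr N).
  assert (Hnz : rising z N <> 0%C) by (apply Cmod_gt_0; lra).
  unfold euler_product.
  rewrite Cmod_div, Cmod_mult, Cmod_R, Rabs_pos_eq by (assumption || apply pos_INR).
  unfold nat_Cpower. rewrite Cmod_Cexp, re_scal_r.
  apply Rmult_le_compat.
  - apply Rmult_le_pos; [ apply pos_INR | left; apply exp_pos ].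
  - left; apply Rinv_0_lt_compat; lra.
  - apply Rmult_le_compat_l; [ apply pos_INR | ].
    apply exp_le. apply Rmult_le_compat_r.
    + rewrite <- ln_1. apply ln_le; [ lra | now apply (le_INR 1) ].
    + eapply Rle_trans; [ apply Rle_abs | ].
      eapply Rle_trans; [ apply re_le_Cmod | exact HR ].
  - apply Rinv_le_contravar; assumption.
Qed.

Lemma euler_logder_bound (z : C) (delta : R) (N : nat) :
  0 < delta ->
  (forall j, delta <= Cmod (z + RtoC (INR j))%C) ->
  Cmod (euler_logder N z) <= Rabs (ln (INR N)) + INR (S N) * / delta.
Proof.
  intros Hd H. unfold euler_logder.
  eapply Rle_trans; [ apply Cmod_triangle | ].
  rewrite Cmod_opp, Cmod_R. apply Rplus_le_compat_l.
  rewrite <- sum_n_const. apply Cmod_sum_n_le.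
  intros j. specialize (H j).
  rewrite Cmod_inv by (apply Cmod_gt_0; lra).
  apply Rinv_le_contravar; assumption.
Qed.

Lemma is_derive_is_lim (f : R -> R) (x l : R) :
  is_derive f x l -> is_lim (fun t => (f t - f x) / (t - x)) x l.
Proof.
  intros H. apply is_derive_Reals in H.
  apply is_lim_spec. intros eps.
  destruct (H eps (cond_pos eps)) as [d Hd].
  exists d. intros t Ht Hne. change (Rabs (t - x) < d) in Ht.
  specialize (Hd (t - x) ltac:(lra) Ht).
  replace (x + (t - x)) with t in Hd by (symmetry; apply Rplus_minus). exact Hd.
Qed.

(** [C_lim] is the limit along the real direction, so the increment [z - z0] in the
    difference quotient of [C_derive] is a real number. *)
Lemma C_derive_horizontal (G : C -> C) (x y : R) (d : C) :
  is_derive_RC (fun t => G (t, y)) x d -> C_derive G (x, y) = d.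
Proof.
  intros [H1 H2]. apply is_derive_is_lim in H1. apply is_derive_is_lim in H2.
  assert (Hq : forall t, t <> x ->
            ((G (t, y) - G (x, y)) / ((t, y) - (x, y)))%C =
            ((Re (G (t, y)) - Re (G (x, y))) / (t - x),
             (Im (G (t, y)) - Im (G (x, y))) / (t - x))).
  { intros t Ht.
    replace ((t, y) - (x, y))%C with (RtoC (t - x)) by (apply C_eq; simpl; ring).
    unfold Cdiv. rewrite <- RtoC_inv by lra.
    apply C_eq; unfold Re, Im; simpl; field; lra. }
  assert (Hl : forall (F f : R -> R) (l : R), (forall t, t <> x -> f t = F t) ->
            is_lim f x l -> real (Lim F x) = l).
  { intros F f l HF Hf. rewrite (is_lim_unique F x l); [ reflexivity | ].
    apply is_lim_ext_loc with f; [ | exact Hf ].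
    exists (mkposreal 1 Rlt_0_1). intros t _ Ht. now apply HF. }
  unfold C_derive, C_lim. apply C_eq.
  - apply (Hl (fun t => Re ((G (t, y) - G (x, y)) / ((t, y) - (x, y)))%C)
             (fun t => (Re (G (t, y)) - Re (G (x, y))) / (t - x)) (Re d));
      [ intros t Ht; now rewrite Hq | exact H1 ].
  - apply (Hl (fun t => Im ((G (t, y) - G (x, y)) / ((t, y) - (x, y)))%C)
             (fun t => (Im (G (t, y)) - Im (G (x, y))) / (t - x)) (Im d));
      [ intros t Ht; now rewrite Hq | exact H2 ].
Qed.
(** On the segment of radius [delta] around [x0] every [z + j] keeps modulus at
    least [delta] and [z] stays bounded, so that the constants [K1], [K2] and the
    starting index [N] of the telescoping estimates can be chosen uniformly.
    Since [P_n' = P_n S_n] with [S_n] the logarithmic derivatives, uniform bounds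
    for [P_n] and [S_n] turn the two step estimates into one for [P_n']. *)
Lemma Gamma_logarithmic_derivative (z : C) :
  (forall j, (z + RtoC (INR j))%C <> 0%C) ->
  exists s, is_Clim_seq (fun n => euler_logder n z) s /\
            Gamma z <> 0%C /\ C_derive Gamma z = (Gamma z * s)%C.
Proof.
  intros H. destruct (poles_at_positive_distance z H) as [delta [Hd Hdist]].
  destruct z as [x0 y]. set (z := (x0, y) : C) in *.
  set (R0 := Cmod z + delta).
  set (D := fun x => Rabs (x - x0) < delta).
  assert (HDx0 : D x0) by (unfold D; rewrite Rminus_diag, Rabs_R0; exact Hd).
  assert (HDR : forall x, D x -> Cmod (x, y) <= R0).
  { intros x Hx. replace (x, y) with (z + RtoC (x - x0))%C
      by (apply C_eq; unfold z; simpl; ring).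
    eapply Rle_trans; [ apply Cmod_triangle | ]. rewrite Cmod_R.
    unfold D in Hx. unfold R0. lra. }
  assert (HDd : forall x, D x -> forall j, delta <= Cmod ((x, y) + RtoC (INR j))%C).
  { intros x Hx j. specialize (Hdist j).
    replace (z + RtoC (INR j))%C with (((x, y) + RtoC (INR j)) + RtoC (x0 - x))%C in Hdist
      by (apply C_eq; unfold z; simpl; ring).
    assert (Ht := Cmod_triangle ((x, y) + RtoC (INR j))%C (RtoC (x0 - x))).
    rewrite Cmod_R, Rabs_minus_sym in Ht. unfold D in Hx. lra. }
  assert (HD0 : forall x, D x -> forall j, ((x, y) + RtoC (INR j))%C <> 0%C).
  { intros x Hx j. specialize (HDd x Hx j). apply Cmod_gt_0. lra. }
  assert (HR0 : 0 <= R0).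
  { assert (H1 := Cmod_ge_0 z). unfold R0. lra. }
  set (K1 := 20 * R0 ^ 2 + 2 * R0). set (K2 := 1 + 2 * R0).
  assert (HK1 : 0 <= K1) by (unfold K1; assert (H1 := pow2_ge_0 R0); lra).
  assert (HK2 : 0 <= K2) by (unfold K2; lra).
  destruct (exists_nat_ge (2 * R0 + 4 * K1)) as [N [HN1 HN]].
  assert (HNn : forall n, (N <= n)%nat -> (1 <= n)%nat /\ 2 * R0 <= INR n).
  { intros n Hn. apply le_INR in Hn as Hn'. split; [ lia | lra ]. }
  assert (Hhalf : forall x n, D x -> (N <= n)%nat ->
            Cmod (euler_product n (x, y) - euler_product N (x, y))%C
            <= / 2 * Cmod (euler_product N (x, y))).
  { intros x n Hx Hn.
    apply (telescoping_product (fun n => euler_product n (x, y)) K1 N);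
      [ exact HN1 | exact HK1 | lra | | exact Hn ].
    intros m Hm. destruct (HNn m Hm). now apply euler_product_step; auto. }
  (* Bounds for [P_n] and [S_n] on the segment, for every [n >= N]. *)
  set (M := 2 * (INR (fact N) * exp (R0 * ln (INR N)) / delta ^ S N)).
  assert (HM : forall x n, D x -> (N <= n)%nat -> Cmod (euler_product n (x, y)) <= M).
  { intros x n Hx Hn. specialize (Hhalf x n Hx Hn).
    assert (HB := euler_product_bound (x, y) R0 delta N HN1 Hd (HDR x Hx) (HDd x Hx)).
    assert (H1 := Cmod_ge_0 (euler_product N (x, y))).
    replace (euler_product n (x, y))
      with ((euler_product n (x, y) - euler_product N (x, y)) + euler_product N (x, y))%C by ring.
    eapply Rle_trans; [ apply Cmod_triangle | ]. unfold M. lra. }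
  assert (HM0 : 0 <= M).
  { eapply Rle_trans; [ apply Cmod_ge_0 | exact (HM x0 N HDx0 (Nat.le_refl N)) ]. }
  assert (HS : forall x n, D x -> (N <= n)%nat ->
            Cmod (euler_logder (S n) (x, y) - euler_logder n (x, y))%C
            <= K2 * (/ INR n - / INR (S n))).
  { intros x n Hx Hn. destruct (HNn n Hn). apply euler_logder_step; auto. }
  set (M' := Rabs (ln (INR N)) + INR (S N) * / delta + K2).
  assert (HM' : forall x n, D x -> (N <= n)%nat -> Cmod (euler_logder n (x, y)) <= M').
  { intros x n Hx Hn.
    assert (HB := euler_logder_bound (x, y) delta N Hd (HDd x Hx)).
    assert (HT := telescoping_Cauchy (fun n => euler_logder n (x, y)) K2 N HN1
                    (fun m Hm => HS x m Hx Hm) N n (Nat.le_refl N) Hn).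
    simpl in HT.
    replace (euler_logder n (x, y))
      with ((euler_logder n (x, y) - euler_logder N (x, y)) + euler_logder N (x, y))%C by ring.
    eapply Rle_trans; [ apply Cmod_triangle | ].
    assert (/ INR N <= 1).
    { rewrite <- Rinv_1. apply Rinv_le_contravar; [ lra | now apply (le_INR 1) ]. }
    assert (0 < / INR n) by (apply Rinv_0_lt_compat, lt_0_INR; lia).
    assert (K2 * (/ INR N - / INR n) <= K2 * 1) by (apply Rmult_le_compat_l; lra).
    unfold M'. lra. }
  assert (HM'0 : 0 <= M').
  { eapply Rle_trans; [ apply Cmod_ge_0 | exact (HM' x0 N HDx0 (Nat.le_refl N)) ]. }
  assert (He : forall n, (N <= n)%nat -> 0 <= / INR n - / INR (S n)).
  { intros n Hn. assert (/ INR (S n) <= / INR n); [ | lra ].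
    apply Rinv_le_contravar; [ apply lt_0_INR; lia | apply le_INR; lia ]. }
  assert (HP : forall x n, D x -> (N <= n)%nat ->
            Cmod (euler_product (S n) (x, y) - euler_product n (x, y))%C
            <= K1 * M * (/ INR n - / INR (S n))).
  { intros x n Hx Hn. destruct (HNn n Hn).
    eapply Rle_trans; [ apply (euler_product_step (x, y) R0); auto | ]. fold K1.
    replace (K1 * M * (/ INR n - / INR (S n)))
      with (K1 * (/ INR n - / INR (S n)) * M) by ring.
    apply Rmult_le_compat_l; [ apply Rmult_le_pos; auto | auto ]. }
  set (K := K1 * M + M * K2 + M' * (K1 * M)).
  assert (HK1M : 0 <= K1 * M) by now apply Rmult_le_pos.
  assert (HMK2 : 0 <= M * K2) by now apply Rmult_le_pos.
  assert (HM'K : 0 <= M' * (K1 * M)) by now apply Rmult_le_pos.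
  destruct (telescoping_is_derive_RC (fun n x => euler_product n (x, y))
              (fun n x => euler_product n (x, y) * euler_logder n (x, y))%C
              x0 delta K N) as [LP [LPS Hder]].
  - exact Hd.
  - exact HN1.
  - unfold K; lra.
  - intros n x Hx. apply is_derive_RC_euler_product, HD0, Hx.
  - intros n x Hx. destruct (ex_derive_RC_euler_logder n x y (HD0 x Hx)) as [e Hse].
    eexists. apply is_derive_RC_mult; [ apply is_derive_RC_euler_product, HD0, Hx | exact Hse ].
  - intros n x Hn Hx. eapply Rle_trans; [ now apply HP | ].
    apply Rmult_le_compat_r; [ now apply He | unfold K; lra ].
  - intros n x Hn Hx.
    replace (_ - _)%C with
      (euler_product (S n) (x, y) * (euler_logder (S n) (x, y) - euler_logder n (x, y))
       + euler_logder n (x, y) * (euler_product (S n) (x, y) - euler_product n (x, y)))%C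
      by ring.
    eapply Rle_trans; [ apply Cmod_triangle | ]. rewrite !Cmod_mult.
    assert (H1 : Cmod (euler_product (S n) (x, y)) *
                 Cmod (euler_logder (S n) (x, y) - euler_logder n (x, y))%C
                 <= M * (K2 * (/ INR n - / INR (S n)))).
    { apply Rmult_le_compat; try apply Cmod_ge_0; [ apply HM; [ exact Hx | lia ] | now apply HS ]. }
    assert (H2 : Cmod (euler_logder n (x, y)) *
                 Cmod (euler_product (S n) (x, y) - euler_product n (x, y))%C
                 <= M' * (K1 * M * (/ INR n - / INR (S n)))).
    { apply Rmult_le_compat; try apply Cmod_ge_0; [ now apply HM' | now apply HP ]. }
    assert (0 <= K1 * M * (/ INR n - / INR (S n))) by (apply Rmult_le_pos; auto).
    unfold K. lra.
  - fold z in LP, LPS. change (is_Clim_seq (fun n => euler_product n z) (Gamma z)) in LP.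
    assert (LS : is_Clim_seq (fun n => euler_logder n z) (CLim_seq (fun n => euler_logder n z))).
    { destruct (telescoping_CVU (fun n x => euler_logder n (x, y)) D K2 N HN1 HK2) as [C1 C2].
      - intros n x Hn Hx. now apply HS.
      - split; [ exact (CVU_cauchy_is_lim_seq _ _ x0 C1 HDx0)
               | exact (CVU_cauchy_is_lim_seq _ _ x0 C2 HDx0) ]. }
    exists (CLim_seq (fun n => euler_logder n z)).
    split; [ exact LS | split ].
    + assert (HPN : 0 < Cmod (euler_product N z)) by (apply Cmod_gt_0, euler_product_neq_0, H).
      (* [P_n] never drops below half of the nonzero [P_N], hence neither does Gamma. *)
      assert (Hge : Rbar_le (/ 2 * Cmod (euler_product N z)) (Cmod (Gamma z))).
      { apply (is_lim_seq_le_loc (fun _ => / 2 * Cmod (euler_product N z))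
                 (fun n => Cmod (euler_product n z)));
          [ | apply is_lim_seq_const | now apply is_Clim_seq_Cmod ].
        exists N. intros n Hn. specialize (Hhalf x0 n HDx0 Hn). fold z in Hhalf.
        assert (Ht := Cmod_triangle (euler_product n z)
                        (- (euler_product n z - euler_product N z))%C).
        replace (euler_product n z + - (euler_product n z - euler_product N z))%C
          with (euler_product N z) in Ht by ring.
        rewrite Cmod_opp in Ht. lra. }
      simpl in Hge. apply Cmod_gt_0. lra.
    + rewrite <- (CLim_seq_unique _ _ (is_Clim_seq_mult _ _ _ _ LP LS)).
      apply (C_derive_horizontal Gamma x0 y). exact Hder.
Qed.

Lemma digamma_lim (z : C) :
  (forall j, (z + RtoC (INR j))%C <> 0%C) ->
  is_Clim_seq (fun n => euler_logder n z) (digamma z).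
Proof.
  intros H. destruct (Gamma_logarithmic_derivative z H) as [s [Hs [HG HD]]].
  replace (digamma z) with s; [ exact Hs | ].
  unfold digamma. rewrite HD. field. exact HG.
Qed.
(** * The functions [c k] as elementary series *)

Lemma sum_n_Cmult_l (a : C) (u : nat -> C) (n : nat) :
  sum_n (fun i => a * u i)%C n = (a * sum_n u n)%C.
Proof. exact (sum_n_mult_l (K := C_Ring) a u n). Qed.

Lemma sum_n_Cmult_r (a : C) (u : nat -> C) (n : nat) :
  sum_n (fun i => u i * a)%C n = (sum_n u n * a)%C.
Proof. exact (sum_n_mult_r (K := C_Ring) a u n). Qed.

Lemma sum_n_Cplus (u v : nat -> C) (n : nat) :
  sum_n (fun i => u i + v i)%C n = (sum_n u n + sum_n v n)%C.
Proof. exact (sum_n_plus (G := C_AbelianMonoid) u v n). Qed.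

Lemma sum_n_CSn (u : nat -> C) (n : nat) : sum_n u (S n) = (sum_n u n + u (S n))%C.
Proof. exact (sum_Sn u n). Qed.

Lemma sum_n_RtoC (u : nat -> R) (n : nat) :
  sum_n (fun i => RtoC (u i)) n = RtoC (sum_n u n).
Proof.
  induction n as [ | n IH ].
  - now rewrite !sum_O.
  - rewrite sum_n_CSn, IH, sum_Sn. symmetry. apply RtoC_plus.
Qed.

Lemma sum_n_shift (u : nat -> C) (n : nat) :
  (sum_n (fun i => u (S i)) n + u 0%nat)%C = (sum_n u n + u (S n))%C.
Proof.
  induction n as [ | n IH ].
  - rewrite !sum_O. ring.
  - rewrite (sum_n_CSn (fun i => u (S i))), (sum_n_CSn u).
    rewrite <- IH. ring.
Qed.

Lemma sum_n_only_last (u : nat -> C) (n : nat) :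
  (forall i, (i < n)%nat -> u i = RtoC 0) -> sum_n u n = u n.
Proof.
  destruct n as [ | n ]; intros H; [ apply sum_O | ].
  rewrite sum_n_CSn, (sum_n_ext_loc u (fun _ => RtoC 0)) by (intros i Hi; apply H; lia).
  assert (H0 : sum_n (fun _ => RtoC 0) n = RtoC 0).
  { exact (sum_n_m_const_zero (G := C_AbelianMonoid) 0 n). }
  rewrite H0. apply Cplus_0_l.
Qed.

Lemma Cexp_Ci (t : R) : Cexp (Ci * RtoC t) = (cos t, sin t).
Proof.
  unfold Cexp, Re, Im. simpl.
  replace (0 * t - 1 * 0) with 0 by ring. replace (0 * 0 + 1 * t) with t by ring.
  now rewrite exp_0, !Rmult_1_l.
Qed.

Lemma Cexp_Ci_pow (t : R) (n : nat) :
  (Cexp (Ci * RtoC t) ^ n)%C = Cexp (Ci * RtoC (INR n * t)).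
Proof.
  induction n as [ | n IH ].
  - change (INR 0) with 0. rewrite (Cexp_Ci (0 * t)). now rewrite Rmult_0_l, cos_0, sin_0.
  - rewrite Cpow_S, IH, <- Cexp_plus. f_equal.
    rewrite S_INR, Rmult_plus_distr_r, Rmult_1_l, RtoC_plus. ring.
Qed.

Lemma omega_angle (k r : nat) :
  omega k r = Cexp (Ci * RtoC (2 * PI * (INR r + / 2) / INR (2 * k + 1))).
Proof.
  unfold omega. f_equal.
  assert (Hq : INR (2 * k + 1) <> 0) by (apply not_0_INR; lia).
  rewrite RtoC_div, !RtoC_mult, RtoC_plus, RtoC_inv by lra.
  field. now apply RtoC_neq_0.
Qed.

Lemma omega_pow_q (k r : nat) : (omega k r ^ (2 * k + 1))%C = RtoC (-1).
Proof.
  assert (Hq : INR (2 * k + 1) <> 0) by (apply not_0_INR; lia).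
  rewrite omega_angle, Cexp_Ci_pow, Cexp_Ci.
  replace (INR (2 * k + 1) * _) with (PI + 2 * INR r * PI) by (field; exact Hq).
  rewrite cos_period, sin_period, cos_PI, sin_PI. reflexivity.
Qed.

(** Multiplying the roots by [zeta = exp (2 pi i / q)] permutes them cyclically, so
    the sum is fixed by multiplication by [zeta^p], which differs from 1 for
    [0 < p < q]. *)
Lemma sum_omega_pow (k p : nat) :
  (1 <= p <= 2 * k)%nat -> sum_n (fun r => omega k r ^ p)%C (2 * k) = RtoC 0.
Proof.
  intros Hp.
  set (q := INR (2 * k + 1)).
  assert (Hq : 0 < q) by (apply lt_0_INR; lia).
  set (zeta := Cexp (Ci * RtoC (2 * PI / q))).
  assert (Hstep : forall r, omega k (S r) = (zeta * omega k r)%C).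
  { intros r. rewrite !omega_angle. unfold zeta. rewrite <- Cexp_plus. f_equal.
    fold q. rewrite S_INR, <- Cmult_plus_distr_l, <- RtoC_plus. do 2 f_equal. field. lra. }
  assert (Hper : omega k (S (2 * k)) = omega k 0).
  { rewrite !omega_angle, !Cexp_Ci. fold q.
    replace (2 * PI * (INR (S (2 * k)) + / 2) / q)
      with (2 * PI * (INR 0 + / 2) / q + 2 * PI).
    - now rewrite cos_plus, sin_plus, cos_2PI, sin_2PI, !Rmult_1_r, !Rmult_0_r,
        Rminus_0_r, Rplus_0_r.
    - replace (INR (S (2 * k))) with q by (unfold q; f_equal; lia).
      simpl INR. field. lra. }
  set (s := sum_n (fun r => omega k r ^ p)%C (2 * k)).
  assert (Hs : (zeta ^ p * s)%C = s).
  { assert (H := sum_n_shift (fun r => omega k r ^ p)%C (2 * k)). cbv beta in H.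
    fold s in H. rewrite Hper in H.
    rewrite (sum_n_ext _ (fun r => zeta ^ p * omega k r ^ p)%C) in H
      by (intros r; now rewrite Hstep, Cpow_mult_l).
    rewrite sum_n_Cmult_l in H. fold s in H.
    replace (zeta ^ p * s)%C with ((zeta ^ p * s + omega k 0 ^ p) - omega k 0 ^ p)%C by ring.
    rewrite H. ring. }
  assert (Hz : (zeta ^ p - 1)%C <> 0%C).
  { unfold zeta. rewrite Cexp_Ci_pow, Cexp_Ci. intros E. apply (f_equal Re) in E.
    simpl in E.
    assert (Hx : 0 < INR p * PI / q < PI).
    { assert (HPI := PI_RGT_0). assert (0 < INR p) by (apply lt_0_INR; lia).
      assert (INR p < q) by (apply lt_INR; lia).
      split; [ apply Rdiv_lt_0_compat; nra | ].
      apply Rmult_lt_reg_r with q; [ exact Hq | ].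
      unfold Rdiv. rewrite Rmult_assoc, Rinv_l by lra. nra. }
    assert (Hsin := sin_gt_0 _ (proj1 Hx) (proj2 Hx)).
    replace (INR p * (2 * PI / q)) with (2 * (INR p * PI / q)) in E by (field; lra).
    rewrite cos_2a_sin in E. nra. }
  assert (Hcancel : forall t : C, (zeta ^ p * t)%C = t -> t = RtoC 0).
  { intros t Ht. replace t with (((zeta ^ p * t) - t) / (zeta ^ p - 1))%C by (field; exact Hz).
    rewrite Ht. field. exact Hz. }
  exact (Hcancel s Hs).
Qed.

Lemma geometric_factor (a x : C) (n : nat) :
  ((a - x) * sum_n (fun i => a ^ (n - i) * x ^ i) n)%C = (a ^ S n - x ^ S n)%C.
Proof.
  induction n as [ | n IH ].
  - rewrite sum_O. simpl. ring.
  - rewrite sum_n_CSn, Nat.sub_diag.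
    rewrite (sum_n_ext_loc _ (fun i => a * (a ^ (n - i) * x ^ i))%C).
    + rewrite sum_n_Cmult_l, (Cpow_S a (S n)), (Cpow_S x (S n)).
      replace ((a - x) * (a * sum_n (fun i => a ^ (n - i) * x ^ i) n + a ^ 0 * x ^ S n))%C
        with (a * ((a - x) * sum_n (fun i => a ^ (n - i) * x ^ i) n) + (a - x) * x ^ S n)%C
        by (simpl; ring).
      rewrite IH. ring.
    + intros i Hi. replace (S n - i)%nat with (S (n - i)) by lia.
      rewrite Cpow_S. eq_in_C. ring.
Qed.

Lemma Cinv_of_mult (u v d : C) : (u * v)%C = d -> d <> 0%C -> (/ u)%C = (v * / d)%C.
Proof.
  intros <- Hd. field. split; intros ->; apply Hd; ring.
Qed.

(** For a root [omega] of [omega^q = -1], the geometric factorisation of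
    [a^q - (omega w)^q] makes [(a^q + w^q) / (a - omega w)] a polynomial in
    [omega].  After multiplication by [omega] and summation over the roots only
    the power [omega^q] survives.  The same identity shows that [a - omega w]
    is not 0: [- omega w] is never a pole of psi. *)
Lemma omega_partial_fractions (k : nat) (a w : R) :
  0 <= a -> 0 < w ->
  (forall r, (- omega k r * RtoC w + RtoC a)%C <> 0%C) /\
  sum_n (fun r => omega k r * / (- omega k r * RtoC w + RtoC a))%C (2 * k) =
  (- RtoC (INR (2 * k + 1)) *
     RtoC (w ^ (2 * k) / (a ^ (2 * k + 1) + w ^ (2 * k + 1))))%C.
Proof.
  intros Ha Hw.
  assert (Haq : 0 <= a ^ (2 * k + 1)) by now apply pow_le.
  assert (Hwq : 0 < w ^ (2 * k + 1)) by now apply pow_lt.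
  set (D := RtoC (a ^ (2 * k + 1) + w ^ (2 * k + 1))).
  assert (HD : D <> 0%C) by (apply RtoC_neq_0; lra).
  assert (Hgeo : forall r,
    ((- omega k r * RtoC w + RtoC a) *
       sum_n (fun i => RtoC a ^ (2 * k - i) * (omega k r * RtoC w) ^ i) (2 * k))%C = D).
  { intros r. replace (- omega k r * RtoC w + RtoC a)%C with (RtoC a - omega k r * RtoC w)%C by ring.
    rewrite geometric_factor. replace (S (2 * k)) with (2 * k + 1)%nat by lia.
    rewrite Cpow_mult_l, omega_pow_q, <- !RtoC_pow. unfold D.
    rewrite RtoC_plus. replace (RtoC (-1)) with (- RtoC 1)%C by (apply C_eq; simpl; ring). ring. }
  assert (Hnz : forall r, (- omega k r * RtoC w + RtoC a)%C <> 0%C).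
  { intros r E. apply HD. rewrite <- (Hgeo r), E. ring. }
  split; [ exact Hnz | ].
  rewrite (sum_n_ext _ (fun r => sum_n (fun i => omega k r ^ S i *
             (RtoC w ^ i * RtoC a ^ (2 * k - i) / D)) (2 * k)))%C.
  2: { intros r.
    assert (Hinv : (/ (- omega k r * RtoC w + RtoC a))%C =
        (sum_n (fun i => RtoC a ^ (2 * k - i) * (omega k r * RtoC w) ^ i) (2 * k) * / D)%C).
    { apply Cinv_of_mult; [ apply Hgeo | exact HD ]. }
    rewrite Hinv, <- sum_n_Cmult_r, <- sum_n_Cmult_l.
    apply sum_n_ext. intros i. rewrite Cpow_mult_l, Cpow_S. eq_in_C. field. exact HD. }
  rewrite (sum_n_switch (fun r i => omega k r ^ S i *
             (RtoC w ^ i * RtoC a ^ (2 * k - i) / D))%C).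
  rewrite (sum_n_ext _ (fun i => sum_n (fun r => omega k r ^ S i) (2 * k) *
             (RtoC w ^ i * RtoC a ^ (2 * k - i) / D)))%C
    by (intros i; now rewrite sum_n_Cmult_r).
  rewrite sum_n_only_last.
  - rewrite Nat.sub_diag.
    rewrite (sum_n_ext _ (fun _ => RtoC (-1))).
    + rewrite sum_n_RtoC, sum_n_const. replace (S (2 * k)) with (2 * k + 1)%nat by lia.
      rewrite RtoC_mult, RtoC_div by lra. fold D. rewrite RtoC_pow.
      replace (RtoC (-1)) with (- RtoC 1)%C by (apply C_eq; simpl; ring).
      simpl (RtoC a ^ 0)%C. eq_in_C. field. exact HD.
    + intros r. replace (S (2 * k)) with (2 * k + 1)%nat by lia. apply omega_pow_q.
  - intros i Hi. rewrite sum_omega_pow by lia. eq_in_C. ring.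
Qed.

Lemma c_series (k : nat) (w : R) :
  (1 <= k)%nat -> 0 < w ->
  is_Clim_seq
    (fun n => RtoC (sum_n (fun j => w ^ (2 * k) / (INR j ^ (2 * k + 1) + w ^ (2 * k + 1))) n))
    (c k w).
Proof.
  intros Hk Hw.
  assert (Hq : RtoC (INR (2 * k + 1)) <> 0%C) by (apply RtoC_neq_0, not_0_INR; lia).
  assert (Hlim : is_Clim_seq (fun n => 1 / RtoC (INR (2 * k + 1)) *
             sum_n (fun r => omega k r * euler_logder n (- omega k r * RtoC w)) (2 * k))%C
             (c k w)).
  { apply is_Clim_seq_mult; [ apply is_Clim_seq_const | ].
    apply (is_Clim_seq_sum_n (fun r n => omega k r * euler_logder n (- omega k r * RtoC w))%C).
    intros r _. apply is_Clim_seq_mult; [ apply is_Clim_seq_const | ].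
    apply digamma_lim. intros j.
    now apply (omega_partial_fractions k (INR j) w (pos_INR j)). }
  eapply is_Clim_seq_ext, Hlim. intros n. cbv beta.
  rewrite (sum_n_ext _ (fun r => omega k r ^ 1 * RtoC (ln (INR n)) +
             (- (1)) * sum_n (fun j => omega k r * / (- omega k r * RtoC w + RtoC (INR j))) n))%C.
  2: { intros r. unfold euler_logder. rewrite sum_n_Cmult_l. simpl. ring. }
  rewrite sum_n_Cplus, sum_n_Cmult_r, sum_omega_pow, Cmult_0_l, Cplus_0_l by lia.
  rewrite sum_n_Cmult_l.
  rewrite (sum_n_switch (fun r j => omega k r * / (- omega k r * RtoC w + RtoC (INR j)))%C).
  rewrite (sum_n_ext _ (fun j => - RtoC (INR (2 * k + 1)) *
             RtoC (w ^ (2 * k) / (INR j ^ (2 * k + 1) + w ^ (2 * k + 1)))))%C.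
  2: { intros j. exact (proj2 (omega_partial_fractions k (INR j) w (pos_INR j) Hw)). }
  rewrite sum_n_Cmult_l, sum_n_RtoC. eq_in_C. field. exact Hq.
Qed.
(** * Double series with a product majorant *)

Lemma ex_series_Cmod (a : nat -> C) (b : nat -> R) :
  (forall n, Cmod (a n) <= b n) -> ex_series b -> ex_series a.
Proof. exact (ex_series_le (V := C_CompleteNormedModule) a b). Qed.

Lemma is_series_Cmod_le (a : nat -> C) (b : nat -> R) (l : C) (L : R) :
  is_series a l -> is_series b L -> (forall n, Cmod (a n) <= b n) -> Cmod l <= L.
Proof.
  intros Ha Hb H. apply is_Clim_seq_filterlim, is_Clim_seq_Cmod in Ha.
  refine (is_lim_seq_le (fun n => Cmod (sum_n a n)) (sum_n b) (Cmod l) L _ Ha Hb).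
  intros n. now apply Cmod_sum_n_le.
Qed.

Lemma is_series_tail_Cmod_le (a : nat -> C) (b : nat -> R) (l : C) (L : R) (N : nat) :
  is_series a l -> is_series b L -> (forall n, Cmod (a n) <= b n) ->
  Cmod (l - sum_n a N)%C <= L - sum_n b N.
Proof.
  intros Ha Hb H.
  apply (is_series_Cmod_le (fun n => a (S N + n)%nat) (fun n => b (S N + n)%nat)).
  - apply (is_series_incr_n a (S N)); [ lia | ]. simpl pred.
    replace (plus _ _) with l; [ exact Ha | ].
    change (l = (l - sum_n a N) + sum_n a N)%C. ring.
  - apply (is_series_incr_n b (S N)); [ lia | ]. simpl pred.
    replace (plus _ _) with L; [ exact Hb | ].
    change (L = (L - sum_n b N) + sum_n b N). ring.
  - intros n. apply H.
Qed.

Lemma is_series_sum_n (a : nat -> nat -> C) (l : nat -> C) (N : nat) :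
  (forall j, is_series (fun i => a i j) (l j)) ->
  is_series (fun i => sum_n (a i) N) (sum_n l N).
Proof.
  intros H. induction N as [ | N IH ].
  - rewrite sum_O. eapply is_series_ext, H. intros i. now rewrite sum_O.
  - rewrite sum_Sn. eapply is_series_ext; [ | apply (is_series_plus _ _ _ _ IH (H (S N))) ].
    intros i. now rewrite sum_Sn.
Qed.

(** The columns [j <= N] may be summed first by linearity; what is left of row
    [i] is at most [u i] times the tail of [v], so the total error is at most the
    sum of [u] times that tail. *)
Lemma double_series_swap (a : nat -> nat -> C) (u v : nat -> R) :
  (forall i, 0 <= u i) -> (forall j, 0 <= v j) -> ex_series u -> ex_series v ->
  (forall i j, Cmod (a i j) <= u i * v j) ->
  exists s : C, is_series (fun i => CSeries (a i)) s /\
            is_series (fun j => CSeries (fun i => a i j)) s.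
Proof.
  intros Hu Hv [U HU] [V HV] H.
  assert (Hrow : forall i, is_series (a i) (CSeries (a i))).
  { intros i. apply CSeries_correct, (ex_series_Cmod _ (fun j => u i * v j)); [ apply H | ].
    apply (ex_series_scal_l (u i) v). now exists V. }
  assert (Hcol : forall j, is_series (fun i => a i j) (CSeries (fun i => a i j))).
  { intros j. apply CSeries_correct, (ex_series_Cmod _ (fun i => v j * u i)).
    - intros i. rewrite Rmult_comm. apply H.
    - apply (ex_series_scal_l (v j) u). now exists U. }
  assert (HuV : forall i, is_series (fun j => u i * v j) (u i * V))
    by (intros i; exact (is_series_scal_l (u i) v V HV)).
  assert (Hs : is_series (fun i => CSeries (a i)) (CSeries (fun i => CSeries (a i)))).
  { apply CSeries_correct, (ex_series_Cmod _ (fun i => V * u i)).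
    - intros i. rewrite Rmult_comm. exact (is_series_Cmod_le _ _ _ _ (Hrow i) (HuV i) (H i)).
    - apply (ex_series_scal_l V u). now exists U. }
  set (s := CSeries (fun i => CSeries (a i))) in *.
  exists s. split; [ exact Hs | ].
  apply is_Clim_seq_filterlim, is_Clim_seq_of_Cmod.
  apply is_lim_seq_le_le with (fun _ => 0) (fun N => (V - sum_n v N) * U).
  - intros N. split; [ apply Cmod_ge_0 | ].
    rewrite Cmod_minus_sym.
    apply (is_series_Cmod_le (fun i => CSeries (a i) - sum_n (a i) N)%C
             (fun i => (V - sum_n v N) * u i)).
    + exact (is_series_minus _ _ _ _ Hs (is_series_sum_n a _ N Hcol)).
    + exact (is_series_scal_l (V - sum_n v N) u U HU).
    + intros i.
      replace ((V - sum_n v N) * u i) with (u i * V - sum_n (fun j => u i * v j) N).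
      * now apply is_series_tail_Cmod_le.
      * assert (E : sum_n (fun j => u i * v j) N = u i * sum_n v N)
          by exact (sum_n_mult_l (K := R_Ring) (u i) v N).
        rewrite E. change (u i * V - u i * sum_n v N = (V - sum_n v N) * u i). ring.
  - apply is_lim_seq_const.
  - replace (Finite 0) with (Finite ((V - V) * U)) by (f_equal; ring).
    apply is_lim_seq_mult'; [ | apply is_lim_seq_const ].
    apply is_lim_seq_minus'; [ apply is_lim_seq_const | exact HV ].
Qed.

(** With [t = s - 1], each term is at most [1 / t] times the decrease of [n^(-t)]
    from [n - 1] to [n], so the partial sums telescope. *)
Lemma ex_series_zeta (s : R) : 1 < s -> ex_series (fun i => Rpower (INR (S i)) (- s)).
Proof.
  intros Hs. set (t := s - 1). set (T := fun n => exp (- t * ln (INR n))).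
  assert (Hstep : forall n, (1 <= n)%nat ->
            Rpower (INR (S n)) (- s) <= (T n - T (S n)) / t).
  { intros n Hn. assert (Hd := ln_succ_bounds n Hn).
    assert (HSn : 0 < INR (S n)) by (apply lt_0_INR; lia).
    assert (HT : T n = T (S n) * exp (t * (ln (INR (S n)) - ln (INR n)))).
    { unfold T. rewrite <- exp_plus. f_equal. ring. }
    assert (HR : Rpower (INR (S n)) (- s) = T (S n) * / INR (S n)).
    { unfold Rpower, T. rewrite <- (exp_ln (INR (S n))) at 3 by exact HSn.
      rewrite <- exp_Ropp, <- exp_plus. f_equal. unfold t. ring. }
    assert (He := exp_ineq1_le (t * (ln (INR (S n)) - ln (INR n)))).
    assert (HTp : 0 < T (S n)) by apply exp_pos.
    apply Rmult_le_reg_r with t; [ unfold t; lra | ].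
    unfold Rdiv. rewrite Rmult_assoc, Rinv_l, Rmult_1_r, HR, HT by (unfold t; lra).
    assert (t * / INR (S n) <= t * (ln (INR (S n)) - ln (INR n)))
      by (apply Rmult_le_compat_l; unfold t in *; lra).
    nra. }
  apply ex_series_incr_1.
  assert (Hsum : forall N, sum_n (fun i => Rpower (INR (S (S i))) (- s)) N
                           <= (T 1%nat - T (S (S N))) / t).
  { induction N as [ | N IH ].
    - rewrite sum_O. apply Hstep; lia.
    - rewrite sum_Sn. change plus with Rplus.
      specialize (Hstep (S (S N)) ltac:(lia)). unfold Rdiv in *. lra. }
  apply ex_finite_lim_seq_incr with (T 1%nat / t).
  - intros N. rewrite sum_Sn. change plus with Rplus.
    assert (H := exp_pos (- s * ln (INR (S (S (S N)))))). unfold Rpower. lra.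
  - intros N. eapply Rle_trans; [ apply Hsum | ].
    apply Rmult_le_compat_r; [ left; apply Rinv_0_lt_compat; unfold t; lra | ].
    assert (H : 0 < T (S (S N))) by apply exp_pos. lra.
Qed.
(** * Regrouping along divisors *)

Lemma nat_Cpower_INR (n p : nat) :
  (1 <= n)%nat -> nat_Cpower n (RtoC (INR p)) = (RtoC (INR n) ^ p)%C.
Proof.
  intros Hn. rewrite <- RtoC_pow, <- Rpower_pow by (apply lt_0_INR; lia).
  unfold nat_Cpower. rewrite <- RtoC_mult. unfold Cexp; simpl.
  now rewrite cos_0, sin_0, Rmult_1_r, Rmult_0_r.
Qed.

Lemma is_series_eventually_0 (a : nat -> C) (N : nat) :
  (forall i, (N < i)%nat -> a i = RtoC 0) -> is_series a (sum_n a N).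
Proof.
  intros H. apply (is_series_decr_n a (S N)); [ lia | ]. simpl pred.
  replace (plus _ _) with (zero : C).
  - apply (is_series_ext (fun _ => zero : C)).
    + intros i. symmetry. apply H. lia.
    + apply is_Clim_seq_filterlim.
      apply (is_Clim_seq_ext (fun _ => RtoC 0)); [ | apply is_Clim_seq_const ].
      intros n. symmetry. exact (sum_n_m_const_zero (G := C_AbelianMonoid) 0 n).
  - symmetry. exact (plus_opp_r (G := C_AbelianGroup) (sum_n a N)).
Qed.

(** The multiples of [m] up to [N] are [m j] for [1 <= j <= N / m]; by induction, as
    [N / m] increases exactly when [m] divides the new index. *)
Lemma sum_over_multiples (m : nat) (b : nat -> C) (N : nat) :
  (1 <= m)%nat ->
  sum_n_m (fun l => if Nat.eqb (l mod m) 0 then b l else RtoC 0) 1 N =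
  sum_n_m (fun j => b (m * j)%nat) 1 (N / m).
Proof.
  intros Hm. induction N as [ | N IH ].
  - rewrite Nat.Div0.div_0_l, !sum_n_m_zero by lia. reflexivity.
  - rewrite sum_n_Sm, IH by lia.
    assert (HN := Nat.div_mod_eq N m). assert (HSN := Nat.div_mod_eq (S N) m).
    assert (HrN := Nat.mod_upper_bound N m ltac:(lia)).
    assert (HrSN := Nat.mod_upper_bound (S N) m ltac:(lia)).
    destruct (Nat.eqb_spec (S N mod m) 0) as [E | E].
    + assert (Hq : (S N / m = S (N / m))%nat) by nia.
      rewrite Hq, sum_n_Sm by lia. do 2 f_equal. nia.
    + assert (Hq : (S N / m = N / m)%nat) by nia.
      rewrite Hq. exact (plus_zero_r (G := C_AbelianMonoid) _).
Qed.

Lemma is_series_multiples (m : nat) (b : nat -> C) (s : C) :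
  (1 <= m)%nat ->
  is_series (fun j => b (m * S j)%nat) s ->
  is_series (fun i => if Nat.eqb (S i mod m) 0 then b (S i) else RtoC 0) s.
Proof.
  intros Hm H.
  assert (HU : filterlim (fun J => sum_n_m (fun j => b (m * j)%nat) 1 J) eventually (locally s)).
  { apply is_Clim_seq_filterlim in H. apply is_Clim_seq_filterlim.
    destruct H as [H1 H2]. split; apply is_lim_seq_incr_1.
    - eapply is_lim_seq_ext, H1. intros n. cbv beta. f_equal.
      exact (sum_n_m_S (fun j => b (m * j)%nat) 0 n).
    - eapply is_lim_seq_ext, H2. intros n. cbv beta. f_equal.
      exact (sum_n_m_S (fun j => b (m * j)%nat) 0 n). }
  apply (filterlim_ext (fun N => sum_n_m (fun j => b (m * j)%nat) 1 (S N / m))).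
  { intros N. rewrite <- sum_over_multiples by exact Hm.
    exact (eq_sym (sum_n_m_S (fun l => if Nat.eqb (l mod m) 0 then b l else RtoC 0) 0 N)). }
  refine (filterlim_comp _ _ _ (fun N => S N / m)%nat _ _ _ _ _ HU).
  intros P [J HJ]. exists (m * J)%nat. intros N HN. apply HJ.
  apply Nat.div_le_lower_bound; lia.
Qed.

Lemma divisor_sum_series (g : nat -> C) (n : nat) :
  is_series (fun i => if Nat.eqb (S n mod S i) 0 then g (S i) else RtoC 0)
            (divisor_sum g (S n)).
Proof.
  unfold divisor_sum.
  rewrite <- (sum_n_m_S (fun d => if Nat.eqb (S n mod d) 0 then g d else RtoC 0) 0 n).
  apply (is_series_eventually_0
           (fun i => if Nat.eqb (S n mod S i) 0 then g (S i) else RtoC 0) n).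
  intros i Hi. rewrite Nat.mod_small by lia. reflexivity.
Qed.

(** [c_series] at [w = n / m], cleared of denominators and deprived of its term
    [j = 0], which equals [m / n]. *)
Lemma c_rational (k m n : nat) :
  (1 <= k)%nat -> (1 <= m)%nat -> (1 <= n)%nat ->
  is_series (fun j => RtoC (/ (INR (m * S j) ^ (2 * k + 1) + INR n ^ (2 * k + 1))))
    ((c k (INR n / INR m) - RtoC (INR m) / RtoC (INR n))
      / (RtoC (INR m) * RtoC (INR n) ^ (2 * k)))%C.
Proof.
  intros Hk Hm Hn.
  assert (Hm0 : 0 < INR m) by (apply lt_0_INR; lia).
  assert (Hn0 : 0 < INR n) by (apply lt_0_INR; lia).
  assert (Hn2 : 0 < INR n ^ (2 * k)) by now apply pow_lt.
  assert (Hm2 : 0 < INR m ^ (2 * k)) by now apply pow_lt.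
  assert (HmC := RtoC_neq_0 (INR m) ltac:(lra)).
  assert (HnC := RtoC_neq_0 (INR n) ltac:(lra)).
  assert (Hn2C := RtoC_neq_0 (INR n ^ (2 * k)) ltac:(lra)).
  set (e := fun j => RtoC (/ (INR (m * j) ^ (2 * k + 1) + INR n ^ (2 * k + 1)))).
  assert (H : is_series (fun j => RtoC (INR m * INR n ^ (2 * k)) * e j)%C
                        (c k (INR n / INR m))).
  { apply is_Clim_seq_filterlim.
    eapply is_Clim_seq_ext; [ | apply c_series; [ exact Hk | now apply Rdiv_lt_0_compat ] ].
    intros N. cbv beta. rewrite <- sum_n_RtoC. apply sum_n_ext. intros j. unfold e.
    rewrite <- RtoC_mult. f_equal. rewrite mult_INR.
    assert (Hj : 0 <= INR j ^ (2 * k)) by apply pow_le, pos_INR.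
    assert (Hj0 := pos_INR j).
    rewrite !pow_add, !pow_1. unfold Rdiv. rewrite !Rpow_mult_distr, pow_inv.
    field. repeat split; try lra; apply Rgt_not_eq; unfold Rgt.
    all: assert (0 <= INR j ^ (2 * k) * INR j) by now apply Rmult_le_pos.
    all: assert (0 < INR n ^ (2 * k) * INR n) by now apply Rmult_lt_0_compat.
    all: assert (0 < INR m ^ (2 * k) * INR m) by now apply Rmult_lt_0_compat.
    all: nra. }
  assert (H0 : (RtoC (INR m * INR n ^ (2 * k)) * e 0%nat)%C = (RtoC (INR m) / RtoC (INR n))%C).
  { unfold e. rewrite Nat.mul_0_r. change (INR 0) with 0. rewrite pow_i by lia.
    rewrite Rplus_0_l, pow_add, pow_1, RtoC_inv by (apply Rgt_not_eq, Rmult_lt_0_compat; lra).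
    rewrite !RtoC_mult. field. repeat split; assumption. }
  assert (H1 : is_series (fun j => RtoC (INR m * INR n ^ (2 * k)) * e (S j))%C
                 (c k (INR n / INR m) - RtoC (INR m) / RtoC (INR n))%C).
  { apply (is_series_incr_1 (fun j => RtoC (INR m * INR n ^ (2 * k)) * e j)%C).
    rewrite H0. replace (plus _ _) with (c k (INR n / INR m)); [ exact H | ].
    change (c k (INR n / INR m) = (c k (INR n / INR m) - RtoC (INR m) / RtoC (INR n))
              + RtoC (INR m) / RtoC (INR n))%C. ring. }
  apply (is_series_scal_l (/ RtoC (INR m * INR n ^ (2 * k)))%C) in H1.
  rewrite <- RtoC_pow, <- RtoC_mult.
  replace (_ / RtoC (INR m * INR n ^ (2 * k)))%C with
    (scal (/ RtoC (INR m * INR n ^ (2 * k)))%C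
       (c k (INR n / INR m) - RtoC (INR m) / RtoC (INR n))%C).
  - eapply is_series_ext, H1. intros j.
    change ((/ RtoC (INR m * INR n ^ (2 * k))) * (RtoC (INR m * INR n ^ (2 * k)) * e (S j))
            = e (S j))%C.
    field. rewrite RtoC_mult. now apply Cmult_neq_0.
  - change ((/ RtoC (INR m * INR n ^ (2 * k))) *
              (c k (INR n / INR m) - RtoC (INR m) / RtoC (INR n))
            = (c k (INR n / INR m) - RtoC (INR m) / RtoC (INR n))
              / RtoC (INR m * INR n ^ (2 * k)))%C.
    unfold Cdiv. ring.
Qed.
(** Both sides sum [g m * b l] over the pairs with [m] dividing [l].  The majorant
    is required on these pairs only, which is where it can have product form. *)
Lemma divisor_series_swap (g b s : nat -> C) (u : nat -> R) (A : R) :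
  0 <= A -> (forall i, 0 <= u i) -> ex_series u ->
  (forall i l, (S l mod S i = 0)%nat -> Cmod (g (S i)) * Cmod (b (S l)) <= A * u i * u l) ->
  (forall i, is_series (fun j => b (S i * S j)%nat) (s (S i))) ->
  exists t : C, is_series (fun i => g (S i) * s (S i))%C t /\
            is_series (fun l => divisor_sum g (S l) * b (S l))%C t.
Proof.
  intros HA Hu Hsu Hgb Hs.
  set (a := fun i l => ((if Nat.eqb (S l mod S i) 0 then g (S i) else RtoC 0) * b (S l))%C).
  destruct (double_series_swap a (fun i => A * u i) u) as [t [Hrow Hcol]].
  - intros i. now apply Rmult_le_pos.
  - exact Hu.
  - exact (ex_series_scal_l A u Hsu).
  - exact Hsu.
  - intros i l. unfold a. rewrite Cmod_mult.
    destruct (Nat.eqb_spec (S l mod S i) 0) as [E | E]; [ now apply Hgb | ].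
    rewrite Cmod_0, Rmult_0_l. repeat apply Rmult_le_pos; auto.
  - exists t. split.
    + eapply is_series_ext, Hrow. intros i. apply CSeries_unique.
      apply (is_series_ext (fun l => g (S i) *
               (if Nat.eqb (S l mod S i) 0 then b (S l) else RtoC 0))%C).
      * intros l. unfold a. destruct (Nat.eqb (S l mod S i) 0); [ reflexivity | ].
        eq_in_C. ring.
      * apply (is_series_scal_l (g (S i))
                 (fun l => if Nat.eqb (S l mod S i) 0 then b (S l) else RtoC 0)).
        apply is_series_multiples; [ lia | apply Hs ].
    + eapply is_series_ext, Hcol. intros l. apply CSeries_unique.
      rewrite Cmult_comm.
      apply (is_series_ext (fun i => b (S l) *
               (if Nat.eqb (S l mod S i) 0 then g (S i) else RtoC 0))%C).
      * intros i. unfold a. eq_in_C. ring.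
      * apply (is_series_scal_l (b (S l))
                 (fun i => if Nat.eqb (S l mod S i) 0 then g (S i) else RtoC 0)).
        apply divisor_sum_series.
Qed.

(** * The symmetric double series *)

Definition stieltjes_kernel (q l n : nat) : C := RtoC (/ (INR l ^ q + INR n ^ q)).

Lemma stieltjes_kernel_sym (q l n : nat) : stieltjes_kernel q l n = stieltjes_kernel q n l.
Proof. unfold stieltjes_kernel. now rewrite Rplus_comm. Qed.

Lemma stieltjes_kernel_bound (q l n : nat) :
  (1 <= l)%nat -> Cmod (stieltjes_kernel q l n) <= / INR l ^ q.
Proof.
  intros Hl. unfold stieltjes_kernel.
  assert (H1 : 0 < INR l ^ q) by (apply pow_lt, lt_0_INR; lia).
  assert (H2 : 0 <= INR n ^ q) by apply pow_le, pos_INR.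
  rewrite Cmod_R, Rabs_pos_eq by (left; apply Rinv_0_lt_compat; lra).
  apply Rinv_le_contravar; lra.
Qed.

(** A discrete Stieltjes transform of the sequence [f n / n^q], evaluated at
    [l^q]. *)
Definition stieltjes (f : nat -> C) (q l : nat) : C :=
  CSeries (fun i => f (S i) / RtoC (INR (S i)) ^ q * stieltjes_kernel q l (S i))%C.

Lemma stieltjes_bound (f : nat -> C) (q l : nat) (v : nat -> R) :
  (1 <= l)%nat -> ex_series v ->
  (forall i, Cmod (f (S i) / RtoC (INR (S i)) ^ q)%C <= v i) ->
  Cmod (stieltjes f q l) <= Series v * / INR l ^ q.
Proof.
  intros Hl Hv Hf.
  assert (Hb : forall i, Cmod (f (S i) / RtoC (INR (S i)) ^ q * stieltjes_kernel q l (S i))%C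
                         <= v i * / INR l ^ q).
  { intros i. rewrite Cmod_mult.
    apply Rmult_le_compat; try apply Cmod_ge_0; [ apply Hf | now apply stieltjes_kernel_bound ]. }
  assert (Hs : is_series (fun i => v i * / INR l ^ q) (Series v * / INR l ^ q))
    by now apply is_series_scal_r, Series_correct.
  refine (is_series_Cmod_le _ _ _ _ (CSeries_correct _ _) Hs Hb).
  apply (ex_series_Cmod _ _ Hb). eexists; exact Hs.
Qed.

Lemma stieltjes_multiples (f : nat -> C) (q m : nat) (u v : nat -> R) :
  (1 <= m)%nat -> ex_series u -> ex_series v ->
  (forall i, / INR (S i) ^ q <= u i) ->
  (forall i, Cmod (f (S i) / RtoC (INR (S i)) ^ q)%C <= v i) ->
  exists s : C,
    is_series (fun i => f (S i) / RtoC (INR (S i)) ^ q *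
                 CSeries (fun j => stieltjes_kernel q (m * S j) (S i)))%C s /\
    is_series (fun j => stieltjes f q (m * S j)) s.
Proof.
  intros Hm Hu Hv Hqu Hf.
  assert (Hu0 : forall i, 0 <= u i).
  { intros i. eapply Rle_trans, Hqu. left. apply Rinv_0_lt_compat, pow_lt, lt_0_INR. lia. }
  assert (Hker : forall i j, Cmod (stieltjes_kernel q (m * S j) i) <= u j).
  { intros i j. eapply Rle_trans; [ apply stieltjes_kernel_bound; nia | ].
    eapply Rle_trans, Hqu. apply Rinv_le_contravar; [ apply pow_lt, lt_0_INR; lia | ].
    apply pow_incr. split; [ apply pos_INR | apply le_INR; nia ]. }
  destruct (double_series_swap
              (fun i j => f (S i) / RtoC (INR (S i)) ^ q * stieltjes_kernel q (m * S j) (S i))%C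
              v u) as [s [Hrow Hcol]]; try assumption.
  - intros i. eapply Rle_trans; [ apply Cmod_ge_0 | apply Hf ].
  - intros i j. rewrite Cmod_mult. apply Rmult_le_compat; try apply Cmod_ge_0; auto.
  - exists s. split; [ | exact Hcol ].
    eapply is_series_ext, Hrow. intros i. apply CSeries_unique.
    apply (is_series_scal_l (f (S i) / RtoC (INR (S i)) ^ q)%C
             (fun j => stieltjes_kernel q (m * S j) (S i))).
    apply CSeries_correct, (ex_series_Cmod _ u); [ intros j; apply Hker | exact Hu ].
Qed.

(** The terms [(l, n)] and [(n, l)] of the double series add up to
    [(f l / l^q) (f n / n^q)], since [1 / n^q + 1 / l^q] cancels the kernel. *)
Lemma stieltjes_symmetrized (f : nat -> C) (q : nat) (v : nat -> R) :
  ex_series v ->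
  (forall i, Cmod (f (S i) / RtoC (INR (S i)) ^ q)%C <= v i) ->
  is_series (fun l => f (S l) * stieltjes f q (S l))%C
    (1 / 2 * CSeries (fun i => f (S i) / RtoC (INR (S i)) ^ q) ^ 2)%C.
Proof.
  intros Hv Hf.
  set (F := fun i => (f (S i) / RtoC (INR (S i)) ^ q)%C) in *.
  assert (Hv0 : forall i, 0 <= v i).
  { intros i. eapply Rle_trans; [ apply Cmod_ge_0 | apply Hf ]. }
  assert (Hpow : forall i, 0 < INR (S i) ^ q) by (intros; apply pow_lt, lt_0_INR; lia).
  assert (HF : is_series F (CSeries F)) by (apply CSeries_correct, (ex_series_Cmod _ v); auto).
  assert (HFC : forall i, F i = (f (S i) / RtoC (INR (S i) ^ q))%C).
  { intros i. unfold F. now rewrite RtoC_pow. }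
  assert (Hfker : forall l n, Cmod (f (S l) * stieltjes_kernel q (S l) (S n))%C <= v l).
  { intros l n. eapply Rle_trans, Hf. fold (F l). rewrite HFC. unfold Cdiv. rewrite !Cmod_mult.
    apply Rmult_le_compat_l; [ apply Cmod_ge_0 | ].
    eapply Rle_trans; [ apply stieltjes_kernel_bound; lia | ].
    rewrite <- RtoC_inv by (apply Rgt_not_eq, Hpow).
    rewrite Cmod_R. apply Rle_abs. }
  set (a := fun l n => (f (S l) * (F n * stieltjes_kernel q (S l) (S n)))%C).
  assert (Ha : forall l n, Cmod (a l n) <= v l * v n).
  { intros l n. unfold a.
    replace (f (S l) * (F n * stieltjes_kernel q (S l) (S n)))%C
      with ((f (S l) * stieltjes_kernel q (S l) (S n)) * F n)%C by ring.
    rewrite Cmod_mult. apply Rmult_le_compat; try apply Cmod_ge_0; [ apply Hfker | apply Hf ]. }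
  destruct (double_series_swap a v v) as [s [Hrow Hcol]]; try assumption.
  assert (Hars : forall l, is_series (a l) (CSeries (a l))).
  { intros l. apply CSeries_correct, (ex_series_Cmod _ (fun n => v l * v n)); [ apply Ha | ].
    exact (ex_series_scal_l (v l) v Hv). }
  assert (Hacs : forall l, is_series (fun n => a n l) (CSeries (fun n => a n l))).
  { intros l. apply CSeries_correct, (ex_series_Cmod _ (fun n => v l * v n)).
    - intros n. rewrite Rmult_comm. apply Ha.
    - exact (ex_series_scal_l (v l) v Hv). }
  assert (Hsym : forall l n, (a l n + a n l = F l * F n)%C).
  { intros l n. unfold a. rewrite (stieltjes_kernel_sym q (S n)), !HFC.
    unfold stieltjes_kernel. assert (Hl := Hpow l). assert (Hn := Hpow n).
    rewrite RtoC_inv, RtoC_plus by lra.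
    field. repeat split; [ | | ]; try (apply RtoC_neq_0; lra).
    rewrite <- RtoC_plus. apply RtoC_neq_0; lra. }
  assert (Hsum : (s + s)%C = (CSeries F ^ 2)%C).
  { assert (H1 : is_series (fun l => CSeries F * F l)%C (s + s)%C).
    { eapply is_series_ext; [ | apply (is_series_plus _ _ _ _ Hrow Hcol) ].
      intros l. cbv beta.
      assert (H2 := is_series_ext _ _ _ (Hsym l) (is_series_plus _ _ _ _ (Hars l) (Hacs l))).
      assert (H3 : is_series (fun n => F l * F n)%C (F l * CSeries F)%C)
        by exact (is_series_scal_l (F l) F _ HF).
      rewrite Cmult_comm, <- (CSeries_unique _ _ H3). exact (eq_sym (CSeries_unique _ _ H2)). }
    assert (H2 : is_series (fun l => CSeries F * F l)%C (CSeries F * CSeries F)%C)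
      by exact (is_series_scal_l (CSeries F) F _ HF).
    rewrite <- (CSeries_unique _ _ H1), (CSeries_unique _ _ H2). simpl. ring. }
  replace (1 / 2 * CSeries F ^ 2)%C with s.
  - eapply is_series_ext, Hrow. intros l. apply CSeries_unique.
    apply (is_series_scal_l (f (S l)) (fun n => F n * stieltjes_kernel q (S l) (S n))%C).
    apply CSeries_correct, (ex_series_Cmod _ (fun n => / INR (S l) ^ q * v n)).
    + intros n. rewrite Cmod_mult, Rmult_comm.
      apply Rmult_le_compat; try apply Cmod_ge_0; [ apply stieltjes_kernel_bound; lia | apply Hf ].
    + exact (ex_series_scal_l (/ INR (S l) ^ q) v Hv).
  - rewrite <- Hsum. field.
Qed.
(** * The identity *)

(** The exponent [s = (3 - alpha) / 2] exceeds 1 and satisfies [alpha + 2 s = 3].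
    Since [a <= b], the factor [a^(alpha + s)] may be replaced by [b^(alpha + s)],
    and [b^(alpha + s) b^(-q)] is at most [b^(alpha + s - 3) = b^(-s)].  Taking [a = 1] or
    [a = b] also yields the plain majorants for [1 / n^q] and [f n / n^q]. *)
Lemma Rpower_tradeoff (alpha a b : R) (q : nat) :
  0 < alpha < 1 -> 1 <= a <= b -> (3 <= q)%nat ->
  Rpower a alpha * / b ^ q <=
  Rpower a (- ((3 - alpha) / 2)) * Rpower b (- ((3 - alpha) / 2)).
Proof.
  intros Hal [Ha Hab] Hq. set (s := (3 - alpha) / 2).
  assert (Hq3 : 3 <= INR q) by (apply (le_INR 3) in Hq; simpl in Hq; lra).
  rewrite <- Rpower_pow, <- Rpower_Ropp by lra.
  assert (H1 : Rpower a (alpha + s) <= Rpower b (alpha + s))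
    by (apply Rle_Rpower_l; unfold s; lra).
  assert (H2 : Rpower b (alpha + s - INR q) <= Rpower b (- s))
    by (apply Rle_Rpower; unfold s; lra).
  replace alpha with ((alpha + s) + - s) at 1 by ring.
  rewrite (Rpower_plus (alpha + s) (- s)), (Rmult_comm (Rpower a _)), Rmult_assoc.
  apply Rmult_le_compat_l; [ left; apply exp_pos | ].
  eapply Rle_trans; [ | exact H2 ].
  unfold Rminus. rewrite (Rpower_plus (alpha + s) (- INR q)).
  apply Rmult_le_compat_r; [ left; apply exp_pos | exact H1 ].
Qed.

Lemma L_INR (f : nat -> C) (p : nat) (v : nat -> R) :
  ex_series v ->
  (forall i, Cmod (f (S i) / RtoC (INR (S i)) ^ p)%C <= v i) ->
  is_series (fun i => f (S i) / RtoC (INR (S i)) ^ p)%C (L (RtoC (INR p)) f).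
Proof.
  intros Hv Hf.
  assert (H : is_series (fun i => f (S i) / nat_Cpower (S i) (RtoC (INR p)))%C
                        (L (RtoC (INR p)) f)).
  { apply CSeries_correct, (ex_series_Cmod _ v); [ | exact Hv ].
    intros i. rewrite nat_Cpower_INR by lia. apply Hf. }
  eapply is_series_ext, H. intros i. cbv beta. now rewrite nat_Cpower_INR by lia.
Qed.

Lemma dominated_nonneg (h : nat -> C) (alpha K : R) :
  (forall n, (1 <= n)%nat -> Cmod (h n) <= K * Rpower (INR n) alpha) -> 0 <= K.
Proof.
  intros H. specialize (H 1%nat (Nat.le_refl 1)).
  assert (H1 : Rpower (INR 1) alpha = 1).
  { unfold Rpower. simpl. now rewrite ln_1, Rmult_0_r, exp_0. }
  rewrite H1 in H. assert (H2 := Cmod_ge_0 (h 1%nat)). lra.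
Qed.

(** The first summand is the [n]-th term of [m L(4k+2; f)], coming from the term
    [j = 0] of [c k (n / m)]. *)
Lemma inner_term_split (f : nat -> C) (k m n : nat) :
  (1 <= k)%nat -> (1 <= m)%nat -> (1 <= n)%nat ->
  inner_term f k m n =
  (RtoC (INR m) * (f n / RtoC (INR n) ^ (4 * k + 2)) +
   RtoC (INR m) * (f n / RtoC (INR n) ^ (2 * k + 1) *
      CSeries (fun j => stieltjes_kernel (2 * k + 1) (m * S j) n)))%C.
Proof.
  intros Hk Hm Hn.
  assert (E := CSeries_unique _ _ (c_rational k m n Hk Hm Hn)).
  assert (HmC : RtoC (INR m) <> 0%C) by (apply RtoC_neq_0, not_0_INR; lia).
  assert (HnC : RtoC (INR n) <> 0%C) by (apply RtoC_neq_0, not_0_INR; lia).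
  unfold stieltjes_kernel. rewrite E. unfold inner_term.
  replace (4 * k + 1)%nat with (2 * k + 2 * k + 1)%nat by lia.
  replace (4 * k + 2)%nat with (2 * k + 2 * k + 1 + 1)%nat by lia.
  assert (Hp := Cpow_nz _ (2 * k) HnC).
  rewrite !Cpow_add_r, !Cpow_1_r.
  field. repeat split; assumption.
Qed.

Theorem theorem6 (g f : nat -> C) (alpha : R)
  (hf : forall n : nat, (1 <= n)%nat -> f n = divisor_sum g n)
  (halpha : (0 < alpha < 1)%R)
  (hfbound : dominated f alpha) (hgbound : dominated g alpha)
  (k : nat) (hk : (1 <= k)%nat) :
  (forall m : nat, (1 <= m)%nat ->
     ex_series (fun i : nat => inner_term f k m (S i))) /\
  is_series
    (fun j : nat =>
       let m := S j in
       (g m / RtoC (INR m) *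
          (CSeries (fun i : nat => inner_term f k m (S i))
           - RtoC (INR m) * L (RtoC (INR (4 * k + 2))) f))%C)
    (1 / 2 * L (RtoC (INR (2 * k + 1))) f ^ 2)%C.
Proof.
  destruct hfbound as [Kf HKf]. destruct hgbound as [Kg HKg].
  assert (HKf0 := dominated_nonneg _ _ _ HKf). assert (HKg0 := dominated_nonneg _ _ _ HKg).
  set (q := (2 * k + 1)%nat).
  set (z := fun i => Rpower (INR (S i)) (- ((3 - alpha) / 2))).
  assert (Hz0 : forall i, 0 <= z i) by (intros; left; apply exp_pos).
  assert (Hz : ex_series z) by (apply ex_series_zeta; lra).
  assert (HS : forall i, 1 <= INR (S i)) by (intros; apply (le_INR 1); lia).
  assert (Hqz : forall i, / INR (S i) ^ q <= z i).
  { intros i.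
    assert (H := Rpower_tradeoff alpha 1 (INR (S i)) q halpha
                   (conj (Rle_refl 1) (HS i)) ltac:(unfold q; lia)).
    unfold Rpower at 1 2 in H. rewrite ln_1, !Rmult_0_r, exp_0, !Rmult_1_l in H. exact H. }
  set (v := fun i => Kf * z i).
  assert (Hv : ex_series v) by exact (ex_series_scal_l Kf z Hz).
  assert (HF : forall p, (3 <= p)%nat -> forall i,
            Cmod (f (S i) / RtoC (INR (S i)) ^ p)%C <= v i).
  { intros p Hp i. specialize (HS i).
    assert (Hpos : 0 < INR (S i) ^ p) by (apply pow_lt; lra).
    rewrite Cmod_div, Cmod_pow, Cmod_R, Rabs_pos_eq
      by (try apply Cpow_nz, RtoC_neq_0; lra).
    assert (H := Rpower_tradeoff alpha (INR (S i)) (INR (S i)) p halpha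
                   (conj HS (Rle_refl _)) Hp).
    fold (z i) in H.
    assert (Hz1 : z i <= 1).
    { unfold z. rewrite <- (Rpower_O (INR (S i))) by lra. apply Rle_Rpower; lra. }
    apply Rle_trans with (Kf * (Rpower (INR (S i)) alpha * / INR (S i) ^ p)).
    - rewrite <- Rmult_assoc. apply Rmult_le_compat_r; [ left; now apply Rinv_0_lt_compat | ].
      apply HKf; lia.
    - apply Rmult_le_compat_l; [ exact HKf0 | ]. specialize (Hz0 i). nra. }
  (* [s m] is the value of the bracket of the statement divided by [m]. *)
  set (s := fun m => CSeries (fun j => stieltjes f q (m * S j))).
  assert (Hs : forall m, (1 <= m)%nat ->
            is_series (fun i => f (S i) / RtoC (INR (S i)) ^ q *
               CSeries (fun j => stieltjes_kernel q (m * S j) (S i)))%C (s m) /\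
            is_series (fun j => stieltjes f q (m * S j)) (s m)).
  { intros m Hm.
    destruct (stieltjes_multiples f q m z v Hm Hz Hv Hqz (HF q ltac:(unfold q; lia)))
      as [t [Ht1 Ht2]].
    unfold s. rewrite (CSeries_unique _ _ Ht2). now split. }
  set (L2 := L (RtoC (INR (4 * k + 2))) f).
  assert (HL2 : is_series (fun i => f (S i) / RtoC (INR (S i)) ^ (4 * k + 2))%C L2)
    by (apply (L_INR f _ v Hv), HF; lia).
  assert (Hinner : forall m, (1 <= m)%nat ->
            is_series (fun i => inner_term f k m (S i))
                      (RtoC (INR m) * L2 + RtoC (INR m) * s m)%C).
  { intros m Hm.
    apply (is_series_ext (fun i =>
             (RtoC (INR m) * (f (S i) / RtoC (INR (S i)) ^ (4 * k + 2)) +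
              RtoC (INR m) * (f (S i) / RtoC (INR (S i)) ^ (2 * k + 1) *
                CSeries (fun j => stieltjes_kernel (2 * k + 1) (m * S j) (S i))))%C)).
    - intros i. now rewrite inner_term_split by lia.
    - apply (is_series_plus
               (fun i => RtoC (INR m) * (f (S i) / RtoC (INR (S i)) ^ (4 * k + 2)))%C).
      + exact (is_series_scal_l (RtoC (INR m)) _ _ HL2).
      + exact (is_series_scal_l (RtoC (INR m)) _ _ (proj1 (Hs m Hm))). }
  split; [ intros m Hm; eexists; now apply Hinner | ].
  assert (HVp : 0 <= Series v).
  { eapply Rle_trans; [ apply (Cmod_ge_0 L2) | ].
    apply (is_series_Cmod_le _ _ _ _ HL2 (Series_correct v Hv)), HF. lia. }
  destruct (divisor_series_swap g (stieltjes f q) s z (Kg * Series v)) as [t [Ht1 Ht2]].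
  - now apply Rmult_le_pos.
  - exact Hz0.
  - exact Hz.
  - intros i l Hdvd.
    assert (Hil : (S i <= S l)%nat).
    { destruct (Nat.lt_ge_cases (S l) (S i)) as [Hlt | Hge]; [ | exact Hge ].
      rewrite Nat.mod_small in Hdvd by exact Hlt. discriminate. }
    assert (HV := stieltjes_bound f q (S l) v ltac:(lia) Hv (HF q ltac:(unfold q; lia))).
    assert (H := Rpower_tradeoff alpha (INR (S i)) (INR (S l)) q halpha
                   (conj (HS i) (le_INR _ _ Hil)) ltac:(unfold q; lia)).
    fold (z i) (z l) in H.
    eapply Rle_trans.
    + apply Rmult_le_compat; try apply Cmod_ge_0; [ apply HKg; lia | exact HV ].
    + replace (Kg * Rpower (INR (S i)) alpha * (Series v * / INR (S l) ^ q))
        with (Kg * Series v * (Rpower (INR (S i)) alpha * / INR (S l) ^ q)) by ring.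
      rewrite (Rmult_assoc _ (z i)). apply Rmult_le_compat_l; [ now apply Rmult_le_pos | exact H ].
  - intros i. apply (Hs (S i)). lia.
  - assert (Ht : t = (1 / 2 * L (RtoC (INR q)) f ^ 2)%C).
    { rewrite <- (CSeries_unique _ _ Ht2).
      rewrite <- (CSeries_unique _ _ (L_INR f q v Hv (HF q ltac:(unfold q; lia)))).
      apply CSeries_unique.
      eapply is_series_ext;
        [ | apply (stieltjes_symmetrized f q v Hv (HF q ltac:(unfold q; lia))) ].
      intros l. cbv beta. now rewrite <- hf by lia. }
    fold q. rewrite <- Ht. eapply is_series_ext, Ht1. intros j. cbv beta zeta.
    rewrite (CSeries_unique _ _ (Hinner (S j) ltac:(lia))).
    eq_in_C. field. apply RtoC_neq_0, not_0_INR; lia.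
Qed.
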